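(* Let $\rho_1,\rho_2$ be locally finite measures on $\Gamma_0$. Suppose that the Radon--Nikodym derivatives with respect to the Lebesgue--Poisson measure $k_i=\dfrac{d\rho_i}{d\lambda}$, $i=1,2$, exist. Then the convolution of measures $\rho=\rho_1\ast\rho_2$ also has a Radon--Nikodym derivative with respect to the Lebesgue--Poisson measure, $k=\dfrac{d\rho}{d\lambda}$, and, moreover, $k=k_1\ast k_2$ (the $\ast$-convolution of functions).
   Context: Let $X$ be a connected oriented non-compact Riemannian $C^\infty$-manifold with Borel $\sigma$-algebra $\mathcal{B}(X)$, and let $\mathcal{B}_{\mathrm c}(X)$ be the class of Borel sets with compact closure. Let $m$ be a non-atomic Radon measure on $X$: $m(\Lambda)<\infty$ for $\Lambda\in\mathcal{B}_{\mathrm c}(X)$ and $m(\{x\})=0$ for $x\in X$. Assume there is an increasing sequence $\Lambda_n\in\mathcal{B}_{\mathrm c}(X)$ with $\bigcup_n\Lambda_n=X$. For $Y\in\mathcal{B}(X)$ and $n\in\mathbb{N}$ let $\Gamma_Y^{(n)}=\{\eta\subset Y: |\eta|=n\}$, where $|\eta|$ is the number of points of $\eta$; $\Gamma_Y^{(0)}=\{\emptyset\}$; $\Gamma^{(n)}=\Gamma^{(n)}_X$. $\Gamma^{(n)}$ is identified with the quotient of $\widetilde{X^n}=\{(x_1,\dots,x_n)\in X^n: x_k\neq x_l \text{ if } k\ne l\}$ by the permutation group $S_n$ and carries the quotient topology. The space of finite configurations is the disjoint union $\Gamma_0=\bigsqcup_{n\ge 0}\Gamma^{(n)}$ with the disjoint-union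 topology and its Borel $\sigma$-algebra $\mathcal{B}(\Gamma_0)$. Let $m^{(n)}$ be the image on $\Gamma^{(n)}$ of $m^{\otimes n}$ (restricted to $\widetilde{X^n}$) under $(x_1,\dots,x_n)\mapsto\{x_1,\dots,x_n\}$, and $m^{(0)}(\{\emptyset\})=1$. The Lebesgue--Poisson measure is $\lambda=\sum_{n=0}^\infty\frac1{n!}m^{(n)}$ on $\Gamma_0$. A set $B\in\mathcal{B}(\Gamma_0)$ is bounded if there exist $\Lambda\in\mathcal{B}_{\mathrm c}(X)$ and $N\in\mathbb{N}$ with $B\subset\bigsqcup_{n=0}^N\Gamma_\Lambda^{(n)}$. A measure $\rho$ on $(\Gamma_0,\mathcal{B}(\Gamma_0))$ is locally finite if $\rho(B)<\infty$ for every bounded $B$. For measurable $G_1,G_2:\Gamma_0\to\mathbb{R}$, the $\ast$-convolution is $(G_1\ast G_2)(\eta)=\sum_{\xi\subset\eta}G_1(\xi)G_2(\eta\setminus\xi)$. Convolution of measures: a measure $\rho$ on $(\Gamma_0,\mathcal{B}(\Gamma_0))$ is the convolution $\rho_1\ast\rho_2$ of measures $\rho_1,\rho_2$ on $(\Gamma_0,\mathcal{B}(\Gamma_0))$ if for every $G:\Gamma_0\to\mathbb{R}$ such that $(\eta^+,\eta^-)\mapsto G(\eta^+\cup\eta^-)$ belongs to $L^1(\Gamma_0\times\Gamma_0,\rho_1\otimes\rho_2)$, $$\int_{\Gamma_0}G(\eta)\,d\rho(\eta)=\int_{\Gamma_0}\int_{\Gamma_0}G(\eta^+\cup\eta^-)\,d\rho_1(\eta^+)\,d\rho_2(\eta^-).$$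 *)

(* Defs.v *)
From HB Require Import structures.
From mathcomp Require Import all_boot all_order all_algebra finmap.
From mathcomp Require Import all_classical all_reals all_analysis.
Set Implicit Arguments.
Unset Strict Implicit.
Unset Printing Implicit Defensive.
Import Order.TTheory GRing.Theory Num.Theory.
Import numFieldNormedType.Exports.
Local Open Scope classical_set_scope.
Local Open Scope ring_scope.

Section smooth.
Context {R : realType} {d : nat}.

Fixpoint Ck_on (W : normedModType R) (k : nat) (U : set 'rV[R]_d)
    (f : 'rV[R]_d -> W) : Prop :=
  (forall y, U y -> {for y, continuous f}) /\
  if k is k'.+1 then
    forall i : 'I_d,
      (forall y, U y -> derivable f y (delta_mx 0 i)) /\
      Ck_on k' U (fun y => 'D_(delta_mx 0 i) f y)
  else True.

(* Meant for open U only. *)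
Definition smooth_on (W : normedModType R) (U : set 'rV[R]_d)
  (f : 'rV[R]_d -> W) : Prop := forall k, Ck_on k U f.

End smooth.

Section manifold.
Variables (R : realType) (d : nat) (X : topologicalType).

(* chart_map is only relevant on chart_dom, and chart_inv on chart_cod. *)
Record chart := Chart {
  chart_dom : set X;
  chart_cod : set 'rV[R]_d;
  chart_map : X -> 'rV[R]_d;
  chart_inv : 'rV[R]_d -> X;
  chart_dom_open : open chart_dom;
  chart_cod_open : open chart_cod;
  chart_mapP : forall x, chart_dom x -> chart_cod (chart_map x);
  chart_invP : forall y, chart_cod y -> chart_dom (chart_inv y);
  chart_mapK : forall x, chart_dom x -> chart_inv (chart_map x) = x;
  chart_invK : forall y, chart_cod y -> chart_map (chart_inv y) = y;
  chart_map_continuous :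
    forall x, chart_dom x -> {for x, continuous chart_map};
  chart_inv_continuous :
    forall y, chart_cod y -> {for y, continuous chart_inv}
}.

Definition transition (c1 c2 : chart) : 'rV[R]_d -> 'rV[R]_d :=
  chart_map c2 \o chart_inv c1.

Definition transition_dom (c1 c2 : chart) : set 'rV[R]_d :=
  [set y | chart_cod c1 y /\ chart_dom c2 (chart_inv c1 y)].

(* The orientation is given by an atlas whose transition maps all have
   positive Jacobian determinant; the metric is given by its Gram matrices
   in the charts of this atlas. The library's Jacobian acts on row vectors
   from the right, which fixes the form of the change-of-chart rule. *)
Record oriented_riemannian_manifold := OrientedRiemannianManifold {
  manifold_hausdorff : hausdorff_space X;
  manifold_second_countable : @second_countable X;
  atlas : set chart;
  atlas_cover : forall x, exists2 c, atlas c & chart_dom c x;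
  atlas_smooth : forall c1 c2, atlas c1 -> atlas c2 ->
    smooth_on (transition_dom c1 c2) (transition c1 c2);
  atlas_oriented : forall c1 c2, atlas c1 -> atlas c2 ->
    forall y, transition_dom c1 c2 y ->
      0 < \det ('J (transition c1 c2) y);
  metric : chart -> 'rV[R]_d -> 'M[R]_d;
  metric_smooth : forall c, atlas c -> forall i j : 'I_d,
    smooth_on (chart_cod c) (fun y => metric c y i j : R^o);
  metric_sym : forall c, atlas c -> forall y, chart_cod c y ->
    (metric c y)^T = metric c y;
  metric_pos : forall c, atlas c -> forall y, chart_cod c y ->
    forall v : 'rV[R]_d, v != 0 -> 0 < (v *m metric c y *m v^T) 0 0;
  metric_transition : forall c1 c2, atlas c1 -> atlas c2 ->
    forall y, transition_dom c1 c2 y ->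
      metric c1 y =
        'J (transition c1 c2) y *m metric c2 (transition c1 c2 y)
          *m ('J (transition c1 c2) y)^T
}.

End manifold.

Notation borel X := (g_sigma_algebraType (@open X)).

Section base_space.
Variables (X : ptopologicalType).

Definition Bc : set (set X) :=
  [set A | measurable (A : set (borel X)) /\ compact (closure A)].

Definition exhaustible : Prop :=
  exists L : nat -> set X,
    [/\ forall n, Bc (L n), {homo L : i j / (i <= j)%N >-> i `<=` j}
      & \bigcup_n L n = setT].

Definition nonatomic_radon (R : realType)
    (m : {measure set (borel X) -> \bar R}) : Prop :=
  (forall A, Bc A -> (m A < +oo)%E) /\ (forall x : X, m [set x] = 0%E).

End base_space.

Definition Gamma0 (X : topologicalType) : Type := {fset X}.

Section configurations.
Variable X : topologicalType.

HB.instance Definition _ := Choice.on (Gamma0 X).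
HB.instance Definition _ := isPointed.Build (Gamma0 X) (fset0 : {fset X}).

Definition Xtilde (n : nat) : set (prod_topology (fun _ : 'I_n => X)) :=
  [set x | injective x].

Definition config (n : nat) (x : 'I_n -> X) : Gamma0 X :=
  [fset x i | i in 'I_n]%fset.

(* Since config identifies the n-point configurations with the quotient of
   Xtilde n by 'S_n, these are the open sets of the disjoint union over n of
   the quotient topologies; Xtilde n has the topology induced by X ^ n. *)
Definition Gamma0_open (U : set (Gamma0 X)) : Prop :=
  forall n, open (@config n @^-1` U : set (subspace (@Xtilde n))).

Let Gamma0_openT : Gamma0_open setT.
Proof. by move=> n; rewrite preimage_setT; exact: openT. Qed.

Let Gamma0_openI (A B : set (Gamma0 X)) :
  Gamma0_open A -> Gamma0_open B -> Gamma0_open (A `&` B).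
Proof. by move=> oA oB n; rewrite preimage_setI; exact: openI. Qed.

Let Gamma0_open_bigU (I : Type) (f : I -> set (Gamma0 X)) :
  (forall i, Gamma0_open (f i)) -> Gamma0_open (\bigcup_i f i).
Proof.
by move=> of_ n; rewrite preimage_bigcup; apply: bigcup_open => i _; exact: of_.
Qed.

HB.instance Definition _ := isOpenTopological.Build (Gamma0 X)
  Gamma0_openT Gamma0_openI Gamma0_open_bigU.

HB.instance Definition _ := Measurable.copy (Gamma0 X) (borel (Gamma0 X)).

Definition GammaY (Y : set X) (n : nat) : set (Gamma0 X) :=
  [set eta : {fset X} | [set` eta] `<=` Y /\ #|` eta| = n].

Definition config_union (xi eta : Gamma0 X) : Gamma0 X :=
  ((xi : {fset X}) `|` (eta : {fset X}))%fset.

Definition star (R : realType) (G1 G2 : Gamma0 X -> R) (eta : Gamma0 X) : R :=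
  \sum_(xi <- fpowerset (eta : {fset X}))
     G1 xi * G2 ((eta : {fset X}) `\` xi)%fset.

End configurations.

Section measures.
Local Open Scope ereal_scope.
Variables (R : realType) (X : ptopologicalType).

Definition config_bounded (B : set (Gamma0 X)) : Prop :=
  measurable B /\
  exists2 L, Bc L & exists N, B `<=` \bigcup_(n in `I_N.+1) GammaY L n.

Definition locally_finite (rho : set (Gamma0 X) -> \bar R) : Prop :=
  forall B, config_bounded B -> rho B < +oo.

(* A measure as soon as m is sigma-finite (as for the library's \x). *)
Fixpoint power_measure (m : set (borel X) -> \bar R) (n : nat) :
    set (n.-tuple (borel X)) -> \bar R :=
  if n is n'.+1 then
    fun A => (m \x @power_measure m n') 
      [set p : borel X * n'.-tuple (borel X) | A [tuple of p.1 :: p.2]]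
  else \d_([tuple] : 0.-tuple (borel X)).

Definition config_measure (m : set (borel X) -> \bar R) (n : nat)
    (A : set (Gamma0 X)) : \bar R :=
  power_measure m
    [set t : n.-tuple (borel X) |
       @Xtilde X n (tnth t) /\ A (@config X n (tnth t))].

Definition lebesgue_poisson (m : set (borel X) -> \bar R)
    (A : set (Gamma0 X)) : \bar R :=
  \sum_(0 <= n <oo) ((n`!%:R : R)^-1)%:E * config_measure m n A.

Definition is_convolution
    (rho1 rho2 rho : set (Gamma0 X) -> \bar R) : Prop :=
  forall G : Gamma0 X -> R,
    (rho1 \x rho2).-integrable setT
      (fun p : Gamma0 X * Gamma0 X => (G (config_union p.1 p.2))%:E) ->
    \int[rho]_eta (G eta)%:E =
    \int[rho2]_em \int[rho1]_ep (G (config_union ep em))%:E.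

(* The library's 'd nu '/d mu only covers finite charges nu. *)
Definition is_RN_derivative d (T : measurableType d)
    (nu mu : set T -> \bar R) (k : T -> R) : Prop :=
  [/\ measurable_fun setT k, (forall x, 0 <= k x)%R
    & forall A, measurable A -> nu A = \int[mu]_(x in A) (k x)%:E].

End measures.

(* Main.v *)
Require Import Defs.
From HB Require Import structures.
From mathcomp Require Import all_boot all_order all_algebra finmap.
From mathcomp Require Import all_classical all_reals all_analysis.
From mathcomp Require Import measurable_realfun.
Set Implicit Arguments.
Unset Strict Implicit.
Unset Printing Implicit Defensive.
Import Order.TTheory GRing.Theory Num.Theory.
Import numFieldNormedType.Exports.
Local Open Scope classical_set_scope.
Local Open Scope ring_scope.

(** The measures rho1 and rho2 have densities k1 and k2 with respect to the
    Lebesgue-Poisson measure lambda. For a bounded measurable set A the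
    indicator of A is an admissible test function for the convolution, hence

      rho A = \int \int 1_A(xi `|` zeta) rho1(d xi) rho2(d zeta)
            = \int \int h(xi, zeta) lambda(d xi) lambda(d zeta)

    with h(xi, zeta) = 1_A(xi `|` zeta) * k1 xi * k2 zeta. Everything rests on
    the identity [lebesgue_poisson_pair], valid for every nonnegative
    measurable h:

      \int \int h(xi, zeta) lambda(d xi) lambda(d zeta)
            = \int (\sum_(xi subset of eta) h(xi, eta \ xi)) lambda(d eta).

    For the h above the inner sum is 1_A(eta) * star k1 k2 eta, so rho A is the
    integral of star k1 k2 over A; countable additivity removes the
    boundedness of A ([convolution_star]). Uniqueness of densities on the
    bounded sets of an exhausting sequence, where rho is finite, gives the
    second claim ([convolution_density_unique]).

    The identity holds level by level. Let J a b be the integral of h over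
    X^a * X^b. The integral of the splitting sum over X^n is
    \sum_(a < n.+1) 'C(n, a) * J a (n - a) ([integral_splitsum]): adding a
    point x to a configuration that does not contain it, x joins either part
    of each splitting ([splitsumU1]), and Pascal's rule closes the induction.
    The configurations that contain x are negligible because m has no atoms
    ([power_measure_mem0]); for the same reason the restriction to injective
    tuples in the definition of lambda costs nothing. As
    'C(n, a) / n! = 1 / (a! (n - a)!), summing over n gives a product of two
    series.

    The measurability statements come from a countable base U of X. A cell
    consists of the configurations with n points that meet each of n pairwise
    disjoint members of U. The countably many cells form a base of the
    topology of the configuration space ([open_cell]), and they belong to the
    sigma-algebra generated by the sets hit V of the configurations meeting an
    open set V. Hence a map into the configuration space is measurable as soon
    as the preimages of these sets are ([measurable_fun_hit]). For the union
    of two configurations, the trace on an open set, and the map from tuples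
    to configurations these preimages are plain. On a cell the points are told
    apart by the members of U, which exhibits the splitting sum as a measurable
    function ([measurable_splitsum]). *)

(** * Cells: a countable base of the configuration space *)

Lemma prod_topology_box (X : topologicalType) n
    (x : prod_topology (fun _ : 'I_n => X)) (V : set (prod_topology _)) :
  nbhs x V -> exists2 W : 'I_n -> set X, forall i, nbhs (x i) (W i) &
    forall y, (forall i, W i (y i)) -> V y.
Proof.
(* The neighbourhoods generated by boxes form a filter converging to x. *)
pose F : set_system (forall _ : 'I_n, X) :=
  [set V | exists2 W : 'I_n -> set X, forall i, nbhs (x i) (W i) &
    forall y, (forall i, W i (y i)) -> V y].
have FF : Filter F.
  split.
  - by exists (fun=> setT) => // i; exact: filterT.
  - move=> A B [W1 nW1 W1A] [W2 nW2 W2B].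
    exists (fun i => W1 i `&` W2 i) => [i|y Wy]; first exact: filterI.
    by split; [apply: W1A|apply: W2B] => i; case: (Wy i).
  - by move=> A B AB [W nW WA]; exists W => // y /WA /AB.
suff : F --> x by apply.
apply/cvg_sup => i A [B [[C oC <-] Cx] BA].
exists (fun j => if j == i then C else setT) => [j|y Wy].
  by case: eqP => [->|_]; [exact: open_nbhs_nbhs|exact: filterT].
by apply: BA; have := Wy i; rewrite eqxx.
Qed.

Lemma second_countable_sequence (X : topologicalType) :
  @second_countable X -> exists2 U : nat -> set X,
    forall i, open (U i) &
    forall x V, nbhs x V -> exists2 i, U i x & U i `<=` V.
Proof.
move=> [B cB [oB bB]]; have [/eqP B0|] := boolP (B == set0).
  exists (fun=> setT) => [i|x V nV]; first exact: openT.
  by have /= [W [+ _] _] := bB x V nV; rewrite B0.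
move=> /set0P [B0 BB0]; have /pfcard_geP := cB; case=> [B00|[f]].
  by move: BB0; rewrite B00.
exists f => [i|x V nV]; first by apply: oB; exact: funS.
have /= [W [BW Wx] WV] := bB x V nV.
by have [i _ fi] := @surj _ _ _ _ f _ BW; exists i; rewrite fi.
Qed.

Lemma separated_nbhs (X : topologicalType) n (x : 'I_n -> X) :
  hausdorff_space X -> injective x ->
  exists2 W : 'I_n -> set X, forall i, nbhs (x i) (W i) &
    forall i j, i != j -> W i `&` W j = set0.
Proof.
rewrite open_hausdorff => hX injx.
have AB p : exists AB : set X * set X, p.1 != p.2 ->
    [/\ nbhs (x p.1) AB.1, nbhs (x p.2) AB.2 & AB.1 `&` AB.2 = set0].
  have [->|pN] := eqVneq p.1 p.2; first by exists (set0, set0).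
  have [|AB [A1 A2] [oA oB /eqP AB0]] := hX (x p.1) (x p.2).
    by apply: contra pN => /eqP /injx ->.
  exists AB => _; split => //; apply: open_nbhs_nbhs; split => //.
    exact: set_mem.
  exact: set_mem.
have [f fP] := choice AB.
exists (fun i =>
    \bigcap_(j in [set j | j != i]) ((f (i, j)).1 `&` (f (j, i)).2)).
  move=> i; have : nbhs (x i) [set y | forall j : 'I_n,
      j != i -> ((f (i, j)).1 `&` (f (j, i)).2) y].
    apply: filter_forall => j; have [->|ji] := eqVneq j i.
      by apply: filterS filterT => y.
    have /= [|A _ _] := fP (i, j); first by rewrite eq_sym.
    have /= [|_ B _] := fP (j, i); first by [].
    by apply: filterS (filterI A B).
  by apply: filterS => y.
move=> i j ij; rewrite -subset0 => y [Wi Wj].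
have [|Ay _] := Wi j; first by rewrite /= eq_sym.
have [|_ By] := Wj i; first by [].
by have [|_ _ d] := fP (i, j); rewrite // -[set0 y]/(set0 y) -d.
Qed.

Section cells.
Variables (X : topologicalType) (hX : hausdorff_space X).
Variables (U : nat -> set X) (oU : forall i, open (U i)).
Hypothesis bU : forall x V, nbhs x V -> exists2 i, U i x & U i `<=` V.
Implicit Types (eta zeta xi : {fset X}) (s : seq nat).

(** The configurations that meet V. *)
Definition hit (V : set X) : set (Gamma0 X) :=
  [set eta | exists2 x, x \in (eta : {fset X}) & V x].

(** The members of the base with indices in s are pairwise disjoint; in
    particular an index repeated in s forces its member to be empty. *)
Definition disj s := pairwise (fun i j => `[< U i `&` U j = set0 >]) s.

(** The configurations that meet U i for every index i in s. *)
Definition hits s : set (Gamma0 X) :=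
  [set eta | forall i, i \in s -> hit (U i) eta].

Lemma hits_step i s eta : disj (i :: s) -> hits (i :: s) eta ->
  exists x, [/\ x \in eta, U i x, (forall j, j \in s -> ~ U j x) &
    hits s (eta `\ x)%fset].
Proof.
rewrite /disj pairwise_cons => /andP[/allP di ds] h.
have [|x xe Ux] := h i; first by rewrite mem_head.
have xN j : j \in s -> ~ U j x.
  by move=> /di /asboolP d0 Ujx; rewrite -[False]/(set0 x) -d0.
exists x; split => // j js.
have [|y ye Uy] := h j; first by rewrite inE js orbT.
exists y => //; rewrite !inE ye andbT; apply/eqP => yx.
by apply: (xN j js); rewrite -yx.
Qed.

Lemma hits_card s eta : disj s -> hits s eta -> (size s <= #|` eta|)%N.
Proof.
elim: s eta => [//|i s IH] eta ds /(hits_step ds)[x [xe Ux _ hs]].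
rewrite (cardfsD1 x) xe /= ltnS; apply: IH => //.
by move: ds; rewrite /disj pairwise_cons => /andP[].
Qed.

(** A configuration of the cell s has exactly one point in each U i, i in s,
    and no other point; the cell is empty unless these sets are disjoint. *)
Definition cell s : set (Gamma0 X) :=
  [set eta | [/\ disj s, hits s eta & #|` (eta : {fset X})| = size s]].

(** A configuration of the cell i :: s is a point of U i added to a
    configuration of the cell s that stays outside U i. Proofs by induction
    on s use it. *)
Lemma cell_step i s eta : cell (i :: s) eta ->
  exists x zeta, [/\ eta = (x |` zeta)%fset, x \notin zeta, U i x,
    cell s zeta & (forall y, y \in zeta -> ~ U i y) /\
    (forall j, j \in s -> ~ U j x)].
Proof.
move=> [ds hs ce].
have ds' : disj s by move: ds; rewrite /disj pairwise_cons => /andP[].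
have [x [xe Ux Nx hs']] := hits_step ds hs.
have ce' : #|` (eta `\ x)%fset| = size s.
  by move: ce; rewrite (cardfsD1 x) xe /= add1n => -[].
exists x, (eta `\ x)%fset; split => //.
- by rewrite fsetD1K.
- by rewrite !inE eqxx.
split => // y; rewrite !inE => /andP[yx ye] Uy.
have : hits s ((eta `\ x) `\ y)%fset.
  move=> j js; have [z] := hs' j js; rewrite !inE => /andP[zx ze] Uz.
  exists z => //; rewrite !inE ze zx !andbT; apply/eqP => zy.
  move: ds; rewrite /disj pairwise_cons => /andP[/allP/(_ j js)/asboolP d _].
  by rewrite -[False]/(set0 y) -d; split => //; rewrite -zy.
move=> /(hits_card ds'); have := ce'; rewrite (cardfsD1 y) !inE yx ye /= => <-.
by rewrite add1n ltnn.
Qed.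

Lemma cell_isolated s eta x : cell s eta -> x \in eta ->
  exists2 i, U i x & forall y, y \in eta -> U i y -> y = x.
Proof.
move=> ce xe.
suff [i []] : exists i, [/\ i \in s, U i x &
    forall y, y \in eta -> U i y -> y = x] by exists i.
elim: s eta ce xe => [|i s IH] eta ce xe.
  by move: ce xe => [_ _ /eqP]; rewrite cardfs_eq0 => /eqP ->; rewrite inE.
have [y [zeta [eE yz Uy cz [zU sU]]]] := cell_step ce.
move: xe; rewrite eE !inE => /orP[/eqP ->|xz].
  exists i; split => //; first exact: mem_head.
  by move=> z; rewrite !inE => /orP[/eqP//|/zU].
have [j [js Ux jU]] := IH _ cz xz.
exists j; split => //; first by rewrite inE js orbT.
move=> z; rewrite !inE => /orP[/eqP -> /(sU j js)//|]; exact: jU.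
Qed.

(** The cells form a base of the topology of the configuration space. *)
Lemma open_cell (W : set (Gamma0 X)) eta : Gamma0_open W -> W eta ->
  exists2 s, cell s eta & cell s `<=` W.
Proof.
move=> oW We.
pose n := #|` eta|.
pose x : prod_topology (fun _ : 'I_n => X) := tnth (in_tuple eta).
have xinj : injective x by apply/tuple_uniqP; exact: fset_uniq.
have xE i : x i \in eta by exact: mem_tnth.
have cx : config x = eta.
  apply/eqP; rewrite eqEfcard; apply/andP; split.
    by apply/fsubsetP => y /imfsetP[i _ ->]; exact: xE.
  by rewrite card_imfset //= size_enum_ord.
have : nbhs (x : subspace (@Xtilde X n)) (@config X n @^-1` W).
  by apply: open_nbhs_nbhs; split; [exact: oW|rewrite /preimage /= cx].
move=> /nbhs_subspace_ex [|V' nV' VV']; first exact: xinj.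
have [W1 nW1 W1V] := prod_topology_box nV'.
have [W2 nW2 W2D] := separated_nbhs hX xinj.
have fE i : exists k, U k (x i) /\ U k `<=` W1 i `&` W2 i.
  by have [k] := bU (filterI (nW1 i) (nW2 i)); exists k.
have [f fP] := choice fE.
pose s := [seq f i | i <- enum 'I_n].
have szs : size s = n by rewrite size_map size_enum_ord.
have fD i j : i != j -> U (f i) `&` U (f j) = set0.
  move=> ij; rewrite -subset0 -(W2D i j ij) => y [Ui Uj].
  by split; [have [] := (fP i).2 _ Ui|have [] := (fP j).2 _ Uj].
have ds : disj s.
  rewrite /disj pairwise_map; have := enum_uniq 'I_n; rewrite uniq_pairwise.
  by apply: sub_pairwise => i j /= ij; apply/asboolP; exact: fD.
exists s.
  split => //.
  by move=> _ /mapP[i _ ->]; exists (x i) => //; case: (fP i).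
move=> zeta [_ hz cz].
have yE i : exists y, y \in (zeta : {fset X}) /\ U (f i) y.
  by have [|y ? ?] := hz (f i); [rewrite map_f// mem_enum|exists y].
have [y yP] := choice yE.
have yinj : injective y.
  move=> i j ij; apply/eqP/negPn/negP => /fD d.
  rewrite -[False]/(set0 (y i)) -d; split; first by case: (yP i).
  by rewrite ij; case: (yP j).
have cy : config y = zeta.
  apply/eqP; rewrite eqEfcard; apply/andP; split.
    by apply/fsubsetP => _ /imfsetP[i _ ->]; case: (yP i).
  by rewrite card_imfset //= size_enum_ord cz szs.
(* zeta is the configuration of the injective tuple y, which lies in the box. *)
rewrite -cy -[W _]/((@config X n @^-1` W) y).
have : (V' `&` @Xtilde X n) y.
  by split => //; apply: W1V => i; have [_ /((fP i).2)[]] := yP i.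
by rewrite -VV' => -[].
Qed.

Lemma hit_open V : open V -> open (hit V).
Proof.
move=> oV; rewrite -[open _]/(Gamma0_open (hit V)) => n.
have -> : @config X n @^-1` hit V =
    \bigcup_(i in setT) ((fun x => x i) @^-1` V).
  apply/seteqP; split => [x [y /imfsetP[i _ ->] Vy]|x [i _ Vx]].
    by exists i.
  by exists (x i) => //; apply/imfsetP; exists i.
have : open (\bigcup_(i in setT)
    ((fun x : prod_topology (fun _ : 'I_n => X) => x i) @^-1` V)).
  apply: bigcup_open => i _; apply: open_comp => // x _.
  exact: (@proj_continuous 'I_n (fun=> X) i).
by move=> o; apply: open_subspaceW.
Qed.

End cells.

(** * Measurable sets and maps on the configuration space *)

Lemma countable_bigcup_measurable d (T : measurableType d) (I : countType)
    (P : set I) (F : I -> set T) :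
  (forall i, P i -> measurable (F i)) -> measurable (\bigcup_(i in P) F i).
Proof.
move=> PF; rewrite bigcup_mkcond; apply: countable_bigcupT_measurable => // i.
by case: ifPn => //; rewrite inE; exact: PF.
Qed.

Lemma mem_config (X : topologicalType) n (x : 'I_n -> X) y :
  y \in (config x : {fset X}) <-> exists i, y = x i.
Proof.
split=> [/imfsetP[i _ ->]|[i ->]]; first by exists i.
by apply/imfsetP; exists i.
Qed.

Section measurability.
Variables (X : ptopologicalType) (hX : hausdorff_space X).
Variables (U : nat -> set X) (oU : forall i, open (U i)).
Hypothesis bU : forall x V, nbhs x V -> exists2 i, U i x & U i `<=` V.
Local Notation G := (Gamma0 X).

Lemma measurable_hit_open (V : set X) : open V -> measurable (hit V : set G).
Proof. by move=> oV; apply: sub_sigma_algebra; exact: hit_open. Qed.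

Lemma hitsE s : hits U s = \bigcap_(i in [set` s]) hit (U i).
Proof. by apply/seteqP; split. Qed.

(** The configurations with at least n points. *)
Definition card_ge n : set G := [set eta | (n <= #|` (eta : {fset X})|)%N].

Lemma cell_exists (eta : G) : exists s, cell U s eta.
Proof.
have [s ? _] := @open_cell X hX U bU setT eta (@openT G) Logic.I.
by exists s.
Qed.

Lemma card_geE n :
  card_ge n = \bigcup_(s in [set s | disj U s /\ size s = n]) hits U s.
Proof.
apply/seteqP; split => [eta ne|eta [s [ds <-]]]; last exact: hits_card.
have [s [ds hs cs]] := cell_exists eta.
exists (take n s).
  split; last by rewrite size_takel// -cs.
  by move: ds; rewrite /disj -{1}(cat_take_drop n s) pairwise_cat => /and3P[].
by move=> i /mem_take /hs.
Qed.

Lemma cellE s : cell U s =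
  if disj U s then hits U s `\` card_ge (size s).+1 else set0.
Proof.
case: ifPn => ds; apply/seteqP; split => [eta|eta] //=.
- by move=> [_ hs cs]; split => //; rewrite /card_ge /= cs ltnn.
- move=> [hs /negP]; rewrite -leqNgt => cs; split => //.
  by apply/eqP; rewrite eqn_leq cs; exact: hits_card hs.
- by move=> [d]; rewrite d in ds.
Qed.

Section into.
Context d (T : measurableType d) (f : T -> G).
Hypothesis mf : forall i, measurable (f @^-1` hit (U i)).

Let mhits s : measurable (f @^-1` hits U s).
Proof.
by rewrite hitsE preimage_bigcap; apply: fin_bigcap_measurable.
Qed.

Let mcard n : measurable (f @^-1` card_ge n).
Proof.
rewrite card_geE preimage_bigcup; apply: countable_bigcup_measurable => s _.
exact: mhits.
Qed.

Let mcell s : measurable (f @^-1` cell U s).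
Proof.
rewrite cellE; case: ifPn => _; last by rewrite preimage_set0.
exact: (measurableD (mhits s) (mcard (size s).+1)).
Qed.

(** The Borel sets of the configuration space are generated by the sets
    hit (U i). *)
Lemma measurable_fun_hit : measurable_fun setT f.
Proof.
apply: (@measurability _ _ _ _ _ _ (@open G)) => // _ [W oW <-].
rewrite setTI (_ : W = \bigcup_(s in [set s | cell U s `<=` W]) cell U s).
  rewrite preimage_bigcup; apply: countable_bigcup_measurable => s _.
  exact: mcell.
apply/seteqP; split => [eta We|eta [s sW]]; last exact: sW.
by have [s ce cW] := open_cell hX bU oW We; exists s.
Qed.

End into.

Lemma measurable_card_ge n : measurable (card_ge n).
Proof.
rewrite card_geE; apply: countable_bigcup_measurable => s _.
rewrite hitsE; apply: fin_bigcap_measurable => // i _.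
exact: measurable_hit_open.
Qed.

Lemma measurable_cell s : measurable (cell U s).
Proof.
rewrite cellE; case: ifPn => // _.
apply: measurableD; last exact: measurable_card_ge.
rewrite hitsE; apply: fin_bigcap_measurable => // i _.
exact: measurable_hit_open.
Qed.

Lemma measurable_card n : measurable [set eta : G | #|` (eta : {fset X})| = n].
Proof.
rewrite (_ : [set _ | _] = card_ge n `\` card_ge n.+1).
  by apply: measurableD; exact: measurable_card_ge.
rewrite /card_ge; apply/seteqP; split => [eta /= ->|eta /= []].
  by rewrite leqnn ltnn.
by move=> ne /negP; rewrite -leqNgt => en; apply/eqP; rewrite eqn_leq en.
Qed.

(** The trace of a configuration on V. *)
Definition restr (V : set X) (eta : G) : G :=
  [fset x in (eta : {fset X}) | `[< V x >]]%fset.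

Lemma mem_restr V (eta : G) x :
  x \in (restr V eta : {fset X}) = (x \in (eta : {fset X})) && `[< V x >].
Proof. by rewrite !inE. Qed.

Lemma hit_restr V W (eta : G) : hit W (restr V eta) <-> hit (V `&` W) eta.
Proof.
split => [[x]|[x xe [Vx Wx]]].
  by rewrite mem_restr => /andP[xe /asboolP Vx] Wx; exists x.
by exists x => //; rewrite mem_restr xe; apply/asboolP.
Qed.

Lemma measurable_restr V : open V -> measurable_fun setT (restr V).
Proof.
move=> oV; apply: measurable_fun_hit => i.
rewrite (_ : _ @^-1` _ = hit (V `&` U i)).
  by apply: measurable_hit_open; exact: openI.
by apply/seteqP; split => eta; rewrite /preimage /= hit_restr.
Qed.

Lemma measurable_config_union :
  measurable_fun setT (fun p : G * G => config_union p.1 p.2).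
Proof.
apply: measurable_fun_hit => i.
rewrite (_ : _ @^-1` _ = fst @^-1` hit (U i) `|` snd @^-1` hit (U i)).
  apply: measurableU; rewrite -[X in measurable X]setTI;
    [apply: measurable_fst|apply: measurable_snd] => //;
    exact: measurable_hit_open.
apply/seteqP; split => [p [x]|p [|] [x xp Ux]].
- by rewrite inE => /orP[] xp Ux; [left|right]; exists x.
- by exists x => //; rewrite inE xp.
- by exists x => //; rewrite inE xp orbT.
Qed.

Lemma measurable_config n : measurable_fun setT
  (fun t : n.-tuple (borel X) => @config X n (tnth t)).
Proof.
apply: measurable_fun_hit => i.
rewrite (_ : _ @^-1` _ = \bigcup_(j in setT) ((fun t => tnth t j) @^-1` U i)).
  apply: countable_bigcup_measurable => j _.
  rewrite -[X in measurable X]setTI; apply: measurable_tnth => //.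
  exact: sub_sigma_algebra.
apply/seteqP; split => [t [x /mem_config[j ->]] Ux|t [j _ Ux]].
  by exists j.
by exists (tnth t j) => //; apply/mem_config; exists j.
Qed.

(** The one-point configuration. *)
Definition single (x : X) : G := [fset x]%fset.

Lemma measurable_single : measurable_fun setT (single : borel X -> G).
Proof.
apply: measurable_fun_hit => i.
rewrite (_ : _ @^-1` _ = U i); first exact: sub_sigma_algebra.
apply/seteqP; split => [x [y]|x Ux].
  by rewrite inE => /eqP ->.
by exists x => //; rewrite inE.
Qed.

(** For open V this is [measurable_hit_open]. On the configurations with exactly
    one point in U i, the set hit (L `&` U i) behaves well under complements
    in L, so that the Borel sets L can be reached from the open ones. *)
Lemma measurable_hit (L : set X) : measurable (L : set (borel X)) ->
  measurable (hit L : set G).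
Proof.
pose D i : set G := restr (U i) @^-1` [set eta | #|` (eta : {fset X})| = 1%N].
have mD i : measurable (D i).
  rewrite -[X in measurable X]setTI; apply: measurable_restr => //.
  exact: measurable_card.
have DP i eta : D i eta -> exists x, [/\ x \in (eta : {fset X}), U i x &
    forall y, y \in (eta : {fset X}) -> U i y -> y = x].
  move=> /eqP /cardfs1P[x xE]; exists x.
  have : x \in (restr (U i) eta : {fset X}) by rewrite xE inE.
  rewrite mem_restr => /andP[xe /asboolP Ux]; split => // y ye Uy.
  have : y \in (restr (U i) eta : {fset X}).
    by rewrite mem_restr ye; apply/asboolP.
  by rewrite xE inE => /eqP.
(* Good sets: the L for which D i `&` hit (L `&` U i) is measurable. *)
have mDL i : measurable (L : set (borel X)) ->
    measurable (D i `&` hit (L `&` U i) : set G).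
  move: L; apply: smallest_sub; last first.
    move=> V oV; apply: measurableI => //.
    by apply: measurable_hit_open; exact: openI.
  split => /=.
  - rewrite set0I (_ : hit set0 = set0) ?setI0 //.
    by apply/seteqP; split => // eta [].
  - move=> V mV; rewrite setTD.
    rewrite (_ : _ `&` _ = D i `\` (D i `&` hit (V `&` U i))).
      exact: measurableD.
    apply/seteqP; split => eta [De h]; split => //.
      move=> [_ [y ye [Vy Uy]]]; have [x [xe Ux xU]] := DP _ _ De.
      by have [z ze [Vz Uz]] := h; apply: Vz; rewrite (xU z)// -(xU y).
    have [x [xe Ux xU]] := DP _ _ De.
    exists x => //; split => // Vx; apply: h; split => //.
    by exists x.
  - move=> F mF.
    rewrite (_ : _ `&` _ = \bigcup_k (D i `&` hit (F k `&` U i))).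
      exact: bigcupT_measurable.
    apply/seteqP; split => [eta [De [x xe [[k _ Fx] Ux]]]|eta [k _ [De]]].
      by exists k => //; split => //; exists x.
    by move=> [x xe [Fx Ux]]; split => //; exists x => //; split => //; exists k.
move=> mL; rewrite (_ : hit L = \bigcup_i (D i `&` hit (L `&` U i))).
  by apply: bigcupT_measurable => i; exact: mDL.
apply/seteqP; split => [eta [x xe Lx]|eta [i _ [_ [x xe [Lx _]]]]]; last first.
  by exists x.
have [s ce] := cell_exists eta.
have [i Ux iU] := cell_isolated ce xe.
exists i => //; split; last by exists x.
rewrite /D /= /preimage /=; apply/eqP/cardfs1P; exists x.
apply/fsetP => z; rewrite mem_restr inE.
apply/andP/eqP => [[ze /asboolP Uz]|->]; first exact: iU.
by split => //; apply/asboolP.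
Qed.

Lemma measurable_GammaY (L : set X) n : measurable (L : set (borel X)) ->
  measurable (GammaY L n : set G).
Proof.
move=> mL; rewrite (_ : GammaY L n =
    [set eta : G | #|` (eta : {fset X})| = n] `\` hit (~` L)).
  apply: measurableD; first exact: measurable_card.
  by apply: measurable_hit; exact: measurableC.
apply/seteqP; split => eta [].
  by move=> eL en; split => // -[x xe]; apply; exact: eL.
move=> en eL; split => // x xe; apply: contrapT => Lx.
by apply: eL; exists x.
Qed.

End measurability.

(** * Sums over the splittings of a configuration *)

Section splitsum.
Variables (K : choiceType) (V : nmodType).
Implicit Types (H : {fset K} -> {fset K} -> V) (A : {fset K}).

(** The sum of H over the ordered splittings of A into two disjoint parts. For
    H a b = G1 a * G2 b it is the star convolution of G1 and G2. *)
Definition splitsum H A : V := \sum_(B <- fpowerset A) H B (A `\` B)%fset.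

Lemma splitsum0 H : splitsum H fset0 = H fset0 fset0.
Proof. by rewrite /splitsum fpowerset0 big_seq_fset1 fsetD0. Qed.

Lemma fpowersetU1_perm x A : x \notin A ->
  perm_eq (fpowerset (x |` A)%fset)
    ([seq (x |` B)%fset | B <- fpowerset A] ++ fpowerset A).
Proof.
move=> xA; apply: uniq_perm; first exact: fset_uniq.
  rewrite cat_uniq fset_uniq andbT map_inj_in_uniq ?fset_uniq/=.
    apply/hasPn => B; rewrite fpowersetE => BA; apply/mapP => -[C _ BE].
    by move: xA; rewrite (fsubsetP BA)// BE !inE eqxx.
  move=> B C; rewrite !fpowersetE => BA CA BC.
  have xN D : (D `<=` A)%fset -> x \notin D.
    by move=> DA; apply: contra xA => /(fsubsetP DA).
  by rewrite -(fsetU1K (xN _ BA)) BC fsetU1K// xN.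
move=> B; rewrite mem_cat fpowersetE; apply/idP/orP.
  move=> BxA; have [xB|xB] := boolP (x \in B).
    left; apply/mapP; exists (B `\ x)%fset; last by rewrite fsetD1K.
    by rewrite fpowersetE fsubDset.
  right; rewrite fpowersetE; apply/fsubsetP => y yB.
  have := fsubsetP BxA _ yB; rewrite !inE => /orP[/eqP yx|//].
  by rewrite -yx yB in xB.
case=> [/mapP[C]|]; rewrite fpowersetE => CA.
  by move=> ->; exact: fsetUS.
by apply: fsubset_trans CA _; exact: fsubsetU1.
Qed.

(** A new point x joins either the first or the second part. *)
Lemma splitsumU1 H x A : x \notin A -> splitsum H (x |` A)%fset =
  splitsum (fun B C => H (x |` B)%fset C) A +
  splitsum (fun B C => H B (x |` C)%fset) A.
Proof.
move=> xA; rewrite /splitsum (perm_big _ (fpowersetU1_perm xA)) /=.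
rewrite big_cat big_map /=.
have xN B : B \in fpowerset A -> x \notin B.
  by rewrite fpowersetE => BA; apply: contra xA => /(fsubsetP BA).
congr (_ + _); apply: eq_big_seq => B BA; congr (H _ _); apply/fsetP => y;
  rewrite !inE; case: (eqVneq y x) => //= ->;
  rewrite ?orbF ?(negbTE (xN _ BA)) //.
by rewrite (negbTE xA).
Qed.

End splitsum.

Section measurable_splitsum.
Variables (X : ptopologicalType) (hX : hausdorff_space X).
Variables (U : nat -> set X) (oU : forall i, open (U i)).
Hypothesis bU : forall x V, nbhs x V -> exists2 i, U i x & U i `<=` V.
Local Notation G := (Gamma0 X).
Variable R : realType.
Variables (H : {fset X} -> {fset X} -> R).
Hypothesis mH : measurable_fun setT (fun p : G * G => H p.1 p.2).

(** The splitting sum of a configuration eta of the cell s, built by allotting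
    its points one by one to the parts a and b: the trace of eta on U i is its
    point in U i. Unlike the splitting sum, it is visibly measurable in eta. *)
Fixpoint cellsum s (a b eta : G) : R :=
  if s is i :: s' then
    cellsum s' (config_union a (restr (U i) eta)) b eta +
    cellsum s' a (config_union b (restr (U i) eta)) eta
  else H a b.

Lemma measurable_cellsum s :
  measurable_fun setT (fun q : G * G * G => cellsum s q.1.1 q.1.2 q.2).
Proof.
have m1 : measurable_fun setT (fun q : G * G * G => q.1.1).
  exact: measurableT_comp.
have m2 : measurable_fun setT (fun q : G * G * G => q.1.2).
  exact: measurableT_comp.
have mr i : measurable_fun setT (fun q : G * G * G => restr (U i) q.2).
  by apply: measurableT_comp => //; exact: (measurable_restr hX oU bU).
have mU := measurable_config_union hX oU bU.
elim: s => [|i s IH] /=.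
  exact: (measurableT_comp mH).
apply: measurable_funD.
  apply: (measurableT_comp IH (g := fun q : G * G * G =>
     (config_union q.1.1 (restr (U i) q.2), q.1.2, q.2))).
  apply/measurable_fun_pair => //; apply/measurable_fun_pair => //.
  by apply: (measurableT_comp mU (g := fun q : G * G * G =>
    (q.1.1, restr (U i) q.2))); exact/measurable_fun_pair.
apply: (measurableT_comp IH (g := fun q : G * G * G =>
   (q.1.1, config_union q.1.2 (restr (U i) q.2), q.2))).
apply/measurable_fun_pair => //; apply/measurable_fun_pair => //.
by apply: (measurableT_comp mU (g := fun q : G * G * G =>
  (q.1.2, restr (U i) q.2))); exact/measurable_fun_pair.
Qed.

Lemma eq_cellsum s a b eta zeta :
  (forall i, i \in s -> restr (U i) eta = restr (U i) zeta) ->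
  cellsum s a b eta = cellsum s a b zeta.
Proof.
elim: s a b => [//|i s IH] a b h /=.
have hs j : j \in s -> restr (U j) eta = restr (U j) zeta.
  by move=> js; apply: h; rewrite inE js orbT.
by rewrite (h i) ?mem_head// !IH.
Qed.

Lemma cellsumE s a b eta : cell U s eta -> cellsum s a b eta =
  splitsum (fun xi zeta => H (config_union a xi) (config_union b zeta)) eta.
Proof.
elim: s a b eta => [|i s IH] a b eta ce.
  move: ce => [_ _ /eqP]; rewrite cardfs_eq0 => /eqP ->.
  by rewrite splitsum0 /= /config_union !fsetU0.
have [x [zeta [eE xz Ux cz [zU sU]]]] := cell_step ce.
have re : restr (U i) eta = [fset x]%fset.
  apply/fsetP => y; rewrite mem_restr eE !inE.
  apply/andP/eqP => [[/orP[/eqP//|/zU yU /asboolP//]]|->].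
  by rewrite eqxx; split => //; exact/asboolP.
have rs j : j \in s -> restr (U j) eta = restr (U j) zeta.
  move=> js; apply/fsetP => y; rewrite !mem_restr eE !inE.
  have [->|//] := eqVneq y x; rewrite /= (negbTE xz).
  by apply/asboolPn; exact: sU.
rewrite /= re !(eq_cellsum _ _ rs) !IH// eE splitsumU1//.
by congr (_ + _); apply: eq_bigr => B _; congr (H _ _);
  rewrite /config_union fsetUA.
Qed.

Lemma measurable_splitsum : measurable_fun setT (splitsum H : G -> R).
Proof.
(* Measurability is checked on each of the countably many cells. *)
pose E n := if @choice.unpickle (seq nat) n is Some s then cell U s else set0.
have mE n : measurable (E n).
  rewrite /E; case: (@choice.unpickle (seq nat) n) => [s|]; last first.
    exact: measurable0.
  exact: (measurable_cell hX oU bU).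
have -> : setT = \bigcup_n E n.
  apply/seteqP; split => // eta _; have [s ce] := cell_exists hX bU eta.
  by exists (choice.pickle s) => //; rewrite /E choice.pickleK.
apply/(measurable_fun_bigcup _ mE) => n; rewrite /E.
case: (@choice.unpickle (seq nat) n) => [s|]; last exact: measurable_fun_set0.
apply: (@eq_measurable_fun _ _ _ _ _ (cellsum s fset0 fset0)).
  move=> eta; rewrite inE => ce; rewrite cellsumE//.
  by apply: eq_bigr => B _; rewrite /config_union !fset0U.
apply: measurable_funTS.
apply: (measurableT_comp (measurable_cellsum s)
  (g := fun eta : G => (fset0 : G, fset0 : G, eta))).
by apply/measurable_fun_pair => //; exact/measurable_cst.
Qed.

End measurable_splitsum.

(** * Powers of a sigma-finite measure *)

(** The image measure as a bundled measure. *)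
Definition pushforward_measure d1 d2 (T1 : measurableType d1)
    (T2 : measurableType d2) (R : realFieldType)
    (mu : {measure set T1 -> \bar R})
    (f : T1 -> T2) (mf : measurable_fun setT f) : {measure set T2 -> \bar R} :=
  measure_function_pushforward__canonical__measure_function_Measure mu mf.

Section as_sigma_finite.
Context d (T : measurableType d) (R : realType).
Variables (mu : {measure set T -> \bar R}) (smu : sigma_finite setT mu).

(** A sigma-finite measure with the same underlying set function as mu. *)
Definition sigma_finite_copy : set T -> \bar R := mu.

HB.instance Definition _ := Measure.on sigma_finite_copy.

Let sigma_finite_copyT : sigma_finite setT sigma_finite_copy.
Proof. exact: smu. Qed.

HB.instance Definition _ := Measure_isSigmaFinite.Build d T R
  sigma_finite_copy sigma_finite_copyT.

Definition as_sigma_finite : {sigma_finite_measure set T -> \bar R} :=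
  sigma_finite_copy.

End as_sigma_finite.

Lemma sigma_finite_product d1 d2 (T1 : measurableType d1)
    (T2 : measurableType d2) (R : realType)
    (m1 : {sigma_finite_measure set T1 -> \bar R})
    (m2 : {sigma_finite_measure set T2 -> \bar R}) :
  sigma_finite setT (m1 \x m2)%E.
Proof.
have /sigma_finiteP[F [TF ndF Foo]] := sigma_finiteT m1.
have /sigma_finiteP[G [TG ndG Goo]] := sigma_finiteT m2.
exists (fun n => F n `*` G n).
  apply/seteqP; split => // -[x y] _.
  have [i _ Fx] : (\bigcup_i F i) x by rewrite -TF.
  have [j _ Gy] : (\bigcup_i G i) y by rewrite -TG.
  exists (maxn i j) => //; split.
    by move: x Fx; exact/subsetPset/ndF/leq_maxl.
  by move: y Gy; exact/subsetPset/ndG/leq_maxr.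
move=> k; have [mF F1] := Foo k; have [mG G1] := Goo k.
split; first exact: measurableX.
by rewrite product_measure1E// lte_mul_pinfty// ge0_fin_numE.
Qed.

Section power_measure.
Local Open Scope ereal_scope.
Variables (R : realType) (X : ptopologicalType).
Variable m : {sigma_finite_measure set (borel X) -> \bar R}.

(** Prepending a point to a tuple, as a map on the product space. *)
Definition tcons n (p : borel X * n.-tuple (borel X)) : n.+1.-tuple (borel X) :=
  [tuple of p.1 :: p.2].

Lemma measurable_tcons n : measurable_fun setT (@tcons n).
Proof. exact: measurable_cons. Qed.

(** The n-th power is a sigma-finite measure. Both properties are proved
    together: its product with m is known to be a measure only once it is
    sigma-finite. *)
Lemma power_measure_exists n :
  exists P : {sigma_finite_measure set (n.-tuple (borel X)) -> \bar R},
    (P : set _ -> \bar R) = @power_measure R X m n.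
Proof.
elim: n => [|n [P PE]]; first by exists (\d_([tuple] : 0.-tuple (borel X))).
pose P' := pushforward_measure (m \x P) (@measurable_tcons n).
have sP' : sigma_finite setT P'.
  have [F FT Foo] := sigma_finite_product m P.
  (* A sigma-finite cover is transported along the inverse g of tcons. *)
  pose g (t : n.+1.-tuple (borel X)) := (thead t, [tuple of behead t]).
  have mg : measurable_fun setT g.
    by apply/measurable_fun_pair;
      [exact: measurable_tnth|exact: measurable_behead].
  exists (fun k => g @^-1` F k).
    by rewrite -preimage_bigcup -FT preimage_setT.
  move=> k; have [mF Fk] := Foo k; split.
    by rewrite -[X in measurable X]setTI; exact: mg.
  rewrite /P' /= /pushforward (_ : _ @^-1` _ = F k)//.
  apply/seteqP; split => -[x t]; rewrite /preimage /= /g /tcons /=;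
    by congr (F k (_, _)); apply/val_inj.
exists (as_sigma_finite sP'); apply/funext => A.
by rewrite /= /pushforward PE.
Qed.

Let pm0 n : @power_measure R X m n set0 = 0.
Proof. by have [P <-] := power_measure_exists n; exact: measure0. Qed.

Let pm_ge0 n A : 0 <= @power_measure R X m n A.
Proof. by have [P <-] := power_measure_exists n; exact: measure_ge0. Qed.

Let pm_additive n : semi_sigma_additive (@power_measure R X m n).
Proof.
by have [P <-] := power_measure_exists n; exact: measure_semi_sigma_additive.
Qed.

HB.instance Definition _ n := isMeasure.Build _ _ _ (@power_measure R X m n)
  (pm0 n) (@pm_ge0 n) (@pm_additive n).

Let pm_sigma_finite n : sigma_finite setT (@power_measure R X m n).
Proof. by have [P <-] := power_measure_exists n; exact: sigma_finiteT. Qed.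

HB.instance Definition _ n := Measure_isSigmaFinite.Build _ _ _
  (@power_measure R X m n) (pm_sigma_finite n).

Local Notation pm n := (@power_measure R X m n).

Lemma power_measureS n : pm n.+1 = pushforward (m \x pm n) (@tcons n).
Proof. by []. Qed.

Lemma integral_power_measureS n (F : n.+1.-tuple (borel X) -> \bar R) :
  measurable_fun setT F -> (forall t, 0 <= F t) ->
  \int[pm n.+1]_t F t = \int[m]_x \int[pm n]_t F (tcons (x, t)).
Proof.
move=> mF F0; rewrite power_measureS.
rewrite (ge0_integral_pushforward (@measurable_tcons n))//.
rewrite preimage_setT fubini_tonelli1//.
  by apply: measurableT_comp => //; exact: measurable_tcons.
by move=> p; exact: F0.
Qed.

Lemma integral_power_measure0 (F : 0.-tuple (borel X) -> \bar R) :
  measurable_fun setT F -> \int[pm 0]_t F t = F [tuple].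
Proof. by move=> mF; rewrite integral_dirac// diracT mul1e. Qed.

Lemma config_tcons n x (t : n.-tuple (borel X)) :
  @config X n.+1 (tnth (tcons (x, t))) =
  config_union (single x) (config (tnth t)).
Proof.
apply/fsetP => y; rewrite !inE; apply/idP/orP.
  move=> /mem_config[i ->]; have [->|i0] := eqVneq i ord0.
    by left; rewrite tnth0.
  right; apply/mem_config.
  case: (unliftP ord0 i) i0 => [j ->|->]; last by rewrite eqxx.
  by exists j; rewrite tnthS.
move=> [/eqP ->|/mem_config[i ->]]; apply/mem_config.
  by exists ord0; rewrite tnth0.
by exists (lift ord0 i); rewrite tnthS.
Qed.

End power_measure.
Arguments power_measure : simpl never.

(** * Tuples with a prescribed or a repeated point are negligible *)

Section null_sets.
Local Open Scope ereal_scope.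
Variables (R : realType) (X : ptopologicalType) (hX : hausdorff_space X).
Variables (U : nat -> set X) (oU : forall i, open (U i)).
Hypothesis bU : forall x V, nbhs x V -> exists2 i, U i x & U i `<=` V.
Variable m : {sigma_finite_measure set (borel X) -> \bar R}.
Hypothesis m1 : forall x, m [set x] = 0.
Local Notation pm n := (@power_measure R X m n).
Local Notation G := (Gamma0 X).

Lemma measurable_set1_borel (x : X) : measurable ([set x] : set (borel X)).
Proof.
rewrite -[X in measurable X]setCK; apply: measurableC; apply: sub_sigma_algebra.
rewrite openC; apply: accessible_closed_set1; exact: hausdorff_accessible.
Qed.

(** The pairs of a point and a tuple that contains it. *)
Definition tuple_mem n : set (borel X * n.-tuple (borel X)) :=
  [set p | exists i, tnth p.2 i = p.1].

Lemma measurable_tuple_mem n : measurable (@tuple_mem n).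
Proof.
have mS := measurable_single hX oU bU.
have mC := measurable_config hX oU bU (n := n).
have mU := measurable_config_union hX oU bU.
pose f (p : borel X * n.-tuple (borel X)) : G := config (tnth p.2).
pose g (p : borel X * n.-tuple (borel X)) : G := config_union (single p.1) (f p).
have mf : measurable_fun setT f by exact: (measurableT_comp mC).
have mg : measurable_fun setT g.
  apply: (measurableT_comp mU (g := fun p : borel X * n.-tuple (borel X) =>
    (single p.1 : G, f p))).
  by apply/measurable_fun_pair => //; exact: (measurableT_comp mS).
pose A k : set G := [set eta | #|` (eta : {fset X})| = k].
(* x is an entry of t iff adding x to the configuration of t leaves the number
   of points unchanged. *)
rewrite (_ : @tuple_mem n = \bigcup_k (f @^-1` A k `&` g @^-1` A k)).
  apply: bigcupT_measurable => k; apply: measurableI;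
    rewrite -[X in measurable X]setTI.
    by apply: mf => //; exact: (measurable_card hX oU bU).
  by apply: mg => //; exact: (measurable_card hX oU bU).
apply/seteqP; split => [[x t] [i /= xi]|[x t] [k _ [/= fk gk]]].
  exists #|` f (x, t)| => //; split => //.
  rewrite /A /preimage /= /g /config_union /single /=.
  rewrite (_ : (_ `|` _)%fset = f (x, t))//.
  apply/fsetUidPr; rewrite fsub1set; apply/mem_config.
  by exists i.
have : x \in (f (x, t) : {fset X}).
  have : #|` g (x, t)| = #|` f (x, t)| by rewrite fk gk.
  rewrite /g /config_union /single /= cardfsU1; case: (x \in _) => //=.
  by rewrite add1n => /eqP; rewrite eqn_leq ltnn.
by move=> /mem_config[i xi]; exists i.
Qed.

Lemma measurable_tuple_mem1 n (x : X) :
  measurable [set t : n.-tuple (borel X) | exists i, tnth t i = x].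
Proof.
have := measurable_xsection (x : borel X) (@measurable_tuple_mem n).
by congr measurable; apply/seteqP; split => t; rewrite /xsection /= inE.
Qed.

Lemma power_measure_mem0 n (x : X) :
  pm n [set t : n.-tuple (borel X) | exists i, tnth t i = x] = 0.
Proof.
elim: n => [|n IH].
  rewrite (_ : [set _ | _] = set0) ?measure0//.
  by apply/seteqP; split => // t [[]].
apply: (@measure_negligible _ _ _ (m \x pm n)).
  rewrite -[X in measurable X]setTI; apply: measurable_tcons => //.
  exact: measurable_tuple_mem1.
pose N : set (borel X * n.-tuple (borel X)) :=
  ([set x] : set (borel X)) `*` setT `|` setT `*`
  [set t : n.-tuple (borel X) | exists i, tnth t i = x].
apply: (@negligibleS _ _ _ (m \x pm n) N).
  move=> [y t] [i]; rewrite /= /tcons.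
  have [->|] := eqVneq i ord0; first by rewrite tnth0 /= => ->; left.
  case: (unliftP ord0 i) => [j -> _|->]; last by rewrite eqxx.
  by rewrite tnthS => tj; right; split => //; exists j.
apply: negligibleU; apply/negligibleP.
- by apply: measurableX => //; exact: measurable_set1_borel.
- apply: etrans (product_measure1E _ _ (measurable_set1_borel x) measurableT) _.
  by rewrite [X in X * _](m1 x) mul0e.
- by apply: measurableX => //; exact: measurable_tuple_mem1.
- have e := product_measure1E m (pm n) (@measurableT _ (borel X))
    (@measurable_tuple_mem1 n x).
  apply: etrans e _. 
  by rewrite [X in _ * X]IH mule0.
Qed.

(** A tuple is injective iff its configuration has as many points as it has
    entries; this makes the set of injective tuples measurable. *)
Lemma XtildeE n : [set t : n.-tuple (borel X) | @Xtilde X n (tnth t)] =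
  (fun t => config (tnth t)) @^-1` [set eta : G | #|` (eta : {fset X})| = n].
Proof.
apply/seteqP; split => t; rewrite /Xtilde /preimage /= => h.
  by rewrite card_imfset //= size_enum_ord.
have : uniq t; last by move/tuple_uniqP.
have e : perm_eq (undup t) (config (tnth t)).
  apply: uniq_perm; [exact: undup_uniq|exact: fset_uniq|move=> y].
  rewrite mem_undup; apply/idP/idP => [/tnthP[i ->]|].
    by apply/mem_config; exists i.
  by move=> /mem_config[i ->]; exact: mem_tnth.
have := ltn_size_undup t.
by rewrite (perm_size e) h size_tuple ltnn => /esym/negbFE.
Qed.

Lemma measurable_Xtilde n :
  measurable [set t : n.-tuple (borel X) | @Xtilde X n (tnth t)].
Proof.
rewrite XtildeE -[X in measurable X]setTI.
apply: (measurable_config hX oU bU) => //; exact: (measurable_card hX oU bU).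
Qed.

Lemma power_measure_Xtilde n :
  pm n (~` [set t : n.-tuple (borel X) | @Xtilde X n (tnth t)]) = 0.
Proof.
elim: n => [|n IH].
  rewrite (_ : ~` _ = set0) ?measure0//.
  by apply/seteqP; split => // t; apply => -[].
apply: (@measure_negligible _ _ _ (m \x pm n)).
  rewrite -[X in measurable X]setTI; apply: measurable_tcons => //.
  by apply: measurableC; exact: measurable_Xtilde.
pose N : set (borel X * n.-tuple (borel X)) := @tuple_mem n `|` setT `*`
    (~` [set t : n.-tuple (borel X) | @Xtilde X n (tnth t)]).
apply: (@negligibleS _ _ _ (m \x pm n) N).
  move=> [y t] ninj; apply: contrapT => /not_orP[ny nt]; apply: ninj.
  have {}nt : injective (tnth t).
    by apply: contrapT => h; apply: nt; split.
  apply/tuple_uniqP; rewrite /= (introT (tuple_uniqP _) nt) andbT.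
  by apply/negP => /tnthP[i yi]; apply: ny; exists i.
apply: negligibleU; apply/negligibleP.
- exact: measurable_tuple_mem.
- rewrite [LHS]integral0_eq// => x _.
  rewrite -(@power_measure_mem0 n x) /=; congr (power_measure _ _).
  by apply/seteqP; split => t; rewrite /xsection /= inE.
- by apply: measurableX => //; apply: measurableC; exact: measurable_Xtilde.
- apply: etrans (product_measure1E m (pm n) (@measurableT _ (borel X))
    (measurableC (@measurable_Xtilde n))) _.
  by rewrite [X in _ * X]IH mule0.
Qed.

End null_sets.

(** * Integration with respect to the Lebesgue-Poisson measure *)

Section lebesgue_poisson_integral.
Local Open Scope ereal_scope.
Variables (R : realType) (X : ptopologicalType) (hX : hausdorff_space X).
Variables (U : nat -> set X) (oU : forall i, open (U i)).
Hypothesis bU : forall x V, nbhs x V -> exists2 i, U i x & U i `<=` V.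
Variable m : {sigma_finite_measure set (borel X) -> \bar R}.
Hypothesis m1 : forall x, m [set x] = 0.
Local Notation pm n := (@power_measure R X m n).
Local Notation G := (Gamma0 X).
Let mconfig n := measurable_config hX oU bU (n := n).
Let munion := measurable_config_union hX oU bU.

(** The non-injective tuples being negligible, the restriction to Xtilde n in
    config_measure can be dropped. *)
Lemma config_measureE n (A : set G) : measurable A ->
  @config_measure R X m n A = pushforward_measure (pm n) (@mconfig n) A.
Proof.
move=> mA.
pose C := (fun t : n.-tuple (borel X) => @config X n (tnth t)) @^-1` A.
pose T := [set t : n.-tuple (borel X) | @Xtilde X n (tnth t)].
have mC : measurable C by rewrite -[X in measurable X]setTI; exact: mconfig.
have mT : measurable T := measurable_Xtilde hX oU bU (n := n).
rewrite /= /pushforward -/C [RHS](measureDI _ mC mT).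
rewrite (@subset_measure0 _ _ _ (pm n) (C `\` T) (~` T)) ?add0e.
- by rewrite setIC.
- exact: measurableD.
- exact: measurableC.
- by move=> t [].
- exact: (power_measure_Xtilde hX oU bU).
Qed.

Lemma invfact_ge0 n : (0 <= (n`!%:R)^-1 :> R)%R.
Proof. by rewrite invr_ge0. Qed.

(** The series of the scaled image measures of the powers of m, without the
    restriction to injective tuples. It agrees with lebesgue_poisson m on
    measurable sets, which is enough for integration. *)
Definition poisson_series : {measure set G -> \bar R} :=
  mseries (fun n => mscale (NngNum (invfact_ge0 n))
    (pushforward_measure (pm n) (@mconfig n))) 0.

Lemma lebesgue_poissonE (A : set G) : measurable A ->
  lebesgue_poisson m A = poisson_series A.
Proof.
move=> mA; apply: eq_eseriesr => n _.
by rewrite config_measureE.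
Qed.

(** The set function lebesgue_poisson m itself, which is a measure. *)
Definition lebesgue_poisson_copy : set G -> \bar R := lebesgue_poisson m.

Let lp0 : lebesgue_poisson_copy set0 = 0.
Proof. by rewrite /lebesgue_poisson_copy lebesgue_poissonE. Qed.

Let lp_ge0 A : 0 <= lebesgue_poisson_copy A.
Proof.
by apply: nneseries_ge0 => n _ _; rewrite mule_ge0 ?lee_fin ?invfact_ge0.
Qed.

Let lp_additive : semi_sigma_additive lebesgue_poisson_copy.
Proof.
move=> F mF tF mUF; rewrite /lebesgue_poisson_copy lebesgue_poissonE//.
under eq_fun do under eq_bigr do rewrite lebesgue_poissonE//.
exact: measure_semi_sigma_additive.
Qed.

HB.instance Definition _ := isMeasure.Build _ _ _ lebesgue_poisson_copy
  lp0 lp_ge0 lp_additive.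

Definition lp_measure : {measure set G -> \bar R} := lebesgue_poisson_copy.

Lemma ge0_integral_lebesgue_poisson (F : G -> \bar R) :
  measurable_fun setT F -> (forall eta, 0 <= F eta) ->
  \int[lp_measure]_eta F eta =
  \sum_(n <oo) ((n`!%:R)^-1)%:E * \int[pm n]_t F (config (tnth t)).
Proof.
move=> mF F0.
rewrite (eq_measure_integral poisson_series) => [|A mA _]; last first.
  exact: lebesgue_poissonE.
rewrite ge0_integral_measure_series//; apply: eq_eseriesr => n _.
rewrite ge0_integral_mscale//; congr (_ * _).
by rewrite (ge0_integral_pushforward (@mconfig n))// preimage_setT.
Qed.

(** The integral of h over pairs of configurations given by an a-tuple and a
    b-tuple of points. *)
Definition pair_integral a b (h : {fset X} -> {fset X} -> R) : \bar R :=
  \int[pm b]_t \int[pm a]_s (h (config (tnth s)) (config (tnth t)))%:E.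

(** Joint measurability of a function of two configurations. *)
Definition measurable2 (h : {fset X} -> {fset X} -> R) :=
  measurable_fun setT (fun p : G * G => h p.1 p.2).

Lemma pair_integral_ge0 a b h : (forall x y, (0 <= h x y)%R) ->
  0 <= pair_integral a b h.
Proof.
move=> h0; apply: integral_ge0 => t _; apply: integral_ge0 => s _.
by rewrite lee_fin.
Qed.

Lemma measurable_pair_integral a b d (T : measurableType d)
    (f : T -> {fset X} -> {fset X} -> R) :
  measurable_fun setT (fun q : T * (G * G) => f q.1 q.2.1 q.2.2) ->
  (forall x y z, (0 <= f x y z)%R) ->
  measurable_fun setT (fun x => pair_integral a b (f x)).
Proof.
move=> mf f0.
pose g2 (q : T * b.-tuple (borel X) * a.-tuple (borel X)) : \bar R :=
  (f q.1.1 (config (tnth q.2)) (config (tnth q.1.2)))%:E.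
have mg2 : measurable_fun setT g2.
  apply/measurable_EFinP.
  apply: (measurableT_comp mf
    (g := fun q : T * b.-tuple (borel X) * a.-tuple (borel X) =>
      (q.1.1, (config (tnth q.2) : G, config (tnth q.1.2) : G)))).
  apply/measurable_fun_pair; first exact: measurableT_comp.
  apply/measurable_fun_pair; first exact: (measurableT_comp (@mconfig a)).
  by apply: (measurableT_comp (@mconfig b)); exact: measurableT_comp.
pose g1 (q : T * b.-tuple (borel X)) : \bar R := \int[pm a]_s g2 (q, s).
have mg1 : measurable_fun setT g1.
  by apply: (measurable_fun_fubini_tonelli_F (m2 := pm a) g2 mg2) => q;
    rewrite lee_fin.
apply: (measurable_fun_fubini_tonelli_F (m2 := pm b) g1 mg1) => q.
by apply: integral_ge0 => s _; rewrite lee_fin.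
Qed.

Lemma measurable2_addl h : measurable2 h ->
  measurable_fun setT (fun q : borel X * (G * G) =>
    h (single q.1 `|` q.2.1)%fset q.2.2).
Proof.
move=> mh.
apply: (measurableT_comp mh (g := fun q : borel X * (G * G) =>
  (config_union (single q.1) q.2.1, q.2.2))).
apply/measurable_fun_pair; last exact: measurableT_comp.
apply: (measurableT_comp munion (g := fun q : borel X * (G * G) =>
  (single q.1 : G, q.2.1))).
apply/measurable_fun_pair; last exact: measurableT_comp.
by apply: (measurableT_comp (measurable_single hX oU bU)).
Qed.

Lemma measurable2_addr h : measurable2 h ->
  measurable_fun setT (fun q : borel X * (G * G) =>
    h q.2.1 (single q.1 `|` q.2.2)%fset).
Proof.
move=> mh.
apply: (measurableT_comp mh (g := fun q : borel X * (G * G) =>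
  (q.2.1, config_union (single q.1) q.2.2))).
apply/measurable_fun_pair; first exact: measurableT_comp.
apply: (measurableT_comp munion (g := fun q : borel X * (G * G) =>
  (single q.1 : G, q.2.2))).
apply/measurable_fun_pair; last exact: measurableT_comp.
by apply: (measurableT_comp (measurable_single hX oU bU)).
Qed.

Lemma measurable_tuple2 h a b : measurable2 h ->
  measurable_fun setT (fun q : b.-tuple (borel X) * a.-tuple (borel X) =>
    (h (config (tnth q.2)) (config (tnth q.1)))%:E).
Proof.
move=> mh; apply/measurable_EFinP.
apply: (measurableT_comp mh
  (g := fun q : b.-tuple (borel X) * a.-tuple (borel X) =>
    (config (tnth q.2) : G, config (tnth q.1) : G))).
apply/measurable_fun_pair; first exact: (measurableT_comp (@mconfig a)).
exact: (measurableT_comp (@mconfig b)).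
Qed.

Lemma pair_integralSr a b h : measurable2 h -> (forall x y, (0 <= h x y)%R) ->
  pair_integral a b.+1 h =
  \int[m]_x pair_integral a b (fun xi zeta => h xi (single x `|` zeta)%fset).
Proof.
move=> mh h0; rewrite /pair_integral integral_power_measureS.
- apply: eq_integral => x _; apply: eq_integral => t _.
  apply: eq_integral => s _.
  by rewrite config_tcons.
- apply: (measurable_fun_fubini_tonelli_F (m2 := pm a) _
    (@measurable_tuple2 h a b.+1 mh)) => q.
  by rewrite lee_fin.
- by move=> t; apply: integral_ge0 => s _; rewrite lee_fin.
Qed.

(** The outer integral over b-tuples is exchanged with the one over the first
    point of the inner tuple. *)
Lemma pair_integralSl a b h : measurable2 h -> (forall x y, (0 <= h x y)%R) ->
  pair_integral a.+1 b h =
  \int[m]_x pair_integral a b (fun xi zeta => h (single x `|` xi)%fset zeta).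
Proof.
move=> mh h0; rewrite /pair_integral.
pose f (p : borel X * b.-tuple (borel X)) := \int[pm a]_s
  (h (single p.1 `|` config (tnth s))%fset (config (tnth p.2)))%:E.
transitivity (\int[pm b]_t \int[m]_x f (x, t)).
  apply: eq_integral => t _; rewrite integral_power_measureS.
  - apply: eq_integral => x _; apply: eq_integral => s _.
    by rewrite config_tcons.
  - have := @measurable_tuple2 h a.+1 b mh.
    by move=> /(measurable_fun_pair2 t).
  - by move=> s; rewrite lee_fin.
rewrite -(fubini_tonelli (m1 := m) (m2 := pm b) f)//; last first.
  by move=> p; apply: integral_ge0 => s _; rewrite lee_fin.
pose g (q : borel X * b.-tuple (borel X) * a.-tuple (borel X)) : \bar R :=
  (h (single q.1.1 `|` config (tnth q.2))%fset (config (tnth q.1.2)))%:E.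
have mg : measurable_fun setT g.
  apply/measurable_EFinP.
  apply: (measurableT_comp (measurable2_addl mh)
    (g := fun q : borel X * b.-tuple (borel X) * a.-tuple (borel X) =>
      (q.1.1, (config (tnth q.2) : G, config (tnth q.1.2) : G)))).
  apply/measurable_fun_pair; first exact: measurableT_comp.
  apply/measurable_fun_pair; first exact: (measurableT_comp (@mconfig a)).
  by apply: (measurableT_comp (@mconfig b)); exact: measurableT_comp.
apply: (measurable_fun_fubini_tonelli_F (m2 := pm a) g mg) => q.
by rewrite lee_fin.
Qed.

End lebesgue_poisson_integral.

(** * Integrals of splitting sums over tuples *)

Section splitsum_integral.
Local Open Scope ereal_scope.
Variables (R : realType) (X : ptopologicalType) (hX : hausdorff_space X).
Variables (U : nat -> set X) (oU : forall i, open (U i)).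
Hypothesis bU : forall x V, nbhs x V -> exists2 i, U i x & U i `<=` V.
Variable m : {sigma_finite_measure set (borel X) -> \bar R}.
Hypothesis m1 : forall x, m [set x] = 0.
Local Notation pm n := (@power_measure R X m n).
Local Notation G := (Gamma0 X).
Let mconfig n := measurable_config hX oU bU (n := n).
Implicit Types h : {fset X} -> {fset X} -> R.

(** Pascal's rule under a weighted sum. *)
Lemma pascal_sum (J : nat -> nat -> \bar R) n : (forall a b, 0 <= J a b) ->
  \sum_(a < n.+2) ('C(n.+1, a)%:R)%:E * J a (n.+1 - a)%N =
  \sum_(a < n.+1) ('C(n, a)%:R)%:E * J a.+1 (n - a)%N +
  \sum_(a < n.+1) ('C(n, a)%:R)%:E * J a (n - a).+1.
Proof.
move=> J0.
have -> : \sum_(a < n.+1) ('C(n, a)%:R)%:E * J a (n - a).+1 =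
    \sum_(a < n.+2) ('C(n, a)%:R)%:E * J a (n.+1 - a)%N.
  rewrite [RHS]big_ord_recr /= bin_small// mul0e adde0.
  by apply: eq_bigr => a _; rewrite subSn// -ltnS.
rewrite [LHS]big_ord_recl [X in _ = _ + X]big_ord_recl /= !bin0 addeCA.
congr (_ + _).
rewrite -big_split /=; apply: eq_bigr => a _.
rewrite /bump /= add1n binS natrD EFinD ge0_muleDl ?lee_fin// subSS.
by rewrite addeC.
Qed.

Lemma splitsum_ge0 h (eta : {fset X}) : (forall x y, (0 <= h x y)%R) ->
  (0 <= splitsum h eta)%R.
Proof. by move=> h0; apply: sumr_ge0 => B _. Qed.

(** Induction on n, separating the first point x of the tuple. Outside the
    negligible set of the tuples containing x, [splitsumU1] expresses the
    splitting sum by those of hl x and hr x, where x is put in the first and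
    in the second part. *)
Lemma integral_splitsum n h : measurable2 h -> (forall x y, (0 <= h x y)%R) ->
  \int[pm n]_t (splitsum h (config (tnth t)))%:E =
  \sum_(a < n.+1) ('C(n, a)%:R)%:E * pair_integral m a (n - a) h.
Proof.
elim: n h => [|n IH] h mh h0.
  have c0 : config (tnth ([tuple] : 0.-tuple (borel X))) = fset0 :> {fset X}.
    by apply/fsetP => y; rewrite inE; apply/negP => /mem_config[[]].
  rewrite big_ord_recl big_ord0 adde0 bin0 mul1e /pair_integral.
  rewrite !integral_power_measure0//.
  - by rewrite c0 splitsum0.
  - apply/measurable_EFinP.
    apply: (measurableT_comp mh (g := fun t : 0.-tuple (borel X) =>
      (config (tnth t) : G, config (tnth ([tuple] : 0.-tuple (borel X))) : G))).
    by apply/measurable_fun_pair; [exact: mconfig|exact: measurable_cst].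
  - apply: (measurable_fun_fubini_tonelli_F (m2 := pm 0) _
      (@measurable_tuple2 _ _ hX _ oU bU h 0 0 mh)) => q.
    by rewrite lee_fin.
  - apply/measurable_EFinP.
    exact: (measurableT_comp (measurable_splitsum hX oU bU mh) (@mconfig 0)).
pose hl x (xi zeta : {fset X}) := h (single x `|` xi)%fset zeta.
pose hr x (xi zeta : {fset X}) := h xi (single x `|` zeta)%fset.
have hl0 x xi zeta : (0 <= hl x xi zeta)%R by exact: h0.
have hr0 x xi zeta : (0 <= hr x xi zeta)%R by exact: h0.
have mhl x : measurable2 (hl x).
  exact: (measurable_fun_pair2 (x : borel X) (measurable2_addl hX oU bU mh)).
have mhr x : measurable2 (hr x).
  exact: (measurable_fun_pair2 (x : borel X) (measurable2_addr hX oU bU mh)).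
have ms (f : {fset X} -> {fset X} -> R) : measurable2 f ->
    measurable_fun setT
      (fun t : n.-tuple (borel X) => (splitsum f (config (tnth t)))%:E).
  move=> mf; apply/measurable_EFinP.
  exact: (measurableT_comp (measurable_splitsum hX oU bU mf) (@mconfig n)).
rewrite integral_power_measureS; last 2 first.
  - apply/measurable_EFinP.
    exact: (measurableT_comp (measurable_splitsum hX oU bU mh) (@mconfig n.+1)).
  - by move=> t; rewrite lee_fin splitsum_ge0.
have inner x : \int[pm n]_t (splitsum h (config (tnth (tcons (x, t)))))%:E =
    \sum_(a < n.+1) ('C(n, a)%:R)%:E * pair_integral m a (n - a) (hl x) +
    \sum_(a < n.+1) ('C(n, a)%:R)%:E * pair_integral m a (n - a) (hr x).
  transitivity (\int[pm n]_t ((splitsum (hl x) (config (tnth t)))%:E +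
                              (splitsum (hr x) (config (tnth t)))%:E)).
    apply: ge0_ae_eq_integral => //.
    - apply/measurable_EFinP.
      apply: (measurableT_comp (measurable_splitsum hX oU bU mh)).
      apply: (measurableT_comp (@mconfig n.+1)).
      exact: (measurable_fun_pair2 (x : borel X) (@measurable_tcons _ n)).
    - by apply: emeasurable_funD; exact: ms.
    - by move=> t _; rewrite lee_fin splitsum_ge0.
    - by move=> t _; rewrite -EFinD lee_fin addr_ge0// splitsum_ge0.
    exists [set t : n.-tuple (borel X) | exists i, tnth t i = x]; split.
    - exact: (measurable_tuple_mem1 hX oU bU).
    - exact: (power_measure_mem0 hX oU bU).
    - move=> t /= h1; apply: contrapT => xt; apply: h1 => _.
      rewrite config_tcons splitsumU1 ?EFinD//.
      by apply/negP => /mem_config[i xi]; apply: xt; exists i.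
  rewrite ge0_integralD//; last 4 first.
  - by move=> t _; rewrite lee_fin splitsum_ge0.
  - exact: ms.
  - by move=> t _; rewrite lee_fin splitsum_ge0.
  - exact: ms.
  by rewrite !IH.
under eq_integral do rewrite inner.
have mJl a : measurable_fun setT
    (fun x : borel X => pair_integral m a (n - a) (hl x)).
  apply: (measurable_pair_integral hX oU bU) => //.
  exact: (measurable2_addl hX oU bU).
have mJr a : measurable_fun setT
    (fun x : borel X => pair_integral m a (n - a) (hr x)).
  apply: (measurable_pair_integral hX oU bU) => //.
  exact: (measurable2_addr hX oU bU).
have J0 a b f : (forall x y, (0 <= f x y)%R) -> 0 <= pair_integral m a b f.
  exact: pair_integral_ge0.
have C0 a (z : \bar R) : 0 <= z -> 0 <= ('C(n, a)%:R)%:E * z.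
  by move=> z0; rewrite mule_ge0// lee_fin.
rewrite ge0_integralD//; last 4 first.
  - by move=> x _; apply: sume_ge0 => a _; apply: C0; exact: J0.
  - by apply: emeasurable_sum => a; exact: measurable_funeM.
  - by move=> x _; apply: sume_ge0 => a _; apply: C0; exact: J0.
  - by apply: emeasurable_sum => a; exact: measurable_funeM.
rewrite (pascal_sum (J := fun a b => pair_integral m a b h))//; last first.
  by move=> a b; exact: J0.
rewrite !ge0_integral_sum//.
- congr (_ + _); apply: eq_bigr => a _; rewrite ge0_integralZl ?lee_fin//.
  + by rewrite (pair_integralSl hX oU bU).
  + by move=> x _; exact: J0.
  + by rewrite (pair_integralSr hX oU bU).
  + by move=> x _; exact: J0.
- by move=> a; exact: measurable_funeM.
- by move=> a x _; apply: C0; exact: J0.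
- by move=> a; exact: measurable_funeM.
- by move=> a x _; apply: C0; exact: J0.
Qed.

End splitsum_integral.

(** * Pairs of configurations under the Lebesgue-Poisson measure *)

Section density.
Local Open Scope ereal_scope.
Import HBNNSimple.

(** Change of variables for a density with no finiteness assumption on either
    measure: simple functions, then monotone convergence. *)
Lemma ge0_integral_density d (T : measurableType d) (R : realType)
    (nu mu : {measure set T -> \bar R}) (k : T -> R) (f : T -> \bar R) :
  measurable_fun setT k -> (forall x, (0 <= k x)%R) ->
  (forall A, measurable A -> nu A = \int[mu]_(x in A) (k x)%:E) ->
  measurable_fun setT f -> (forall x, 0 <= f x) ->
  \int[nu]_x f x = \int[mu]_x (f x * (k x)%:E).
Proof.
move=> mk k0 nuE mf f0; pose h := nnsfun_approx measurableT mf.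
have mk' : measurable_fun setT (EFin \o k) by exact/measurable_EFinP.
have -> : \int[nu]_x f x = lim (\int[nu]_x (EFin \o h n) x @[n --> \oo]).
  have fE x : f x = lim ((EFin \o h n) x @[n --> \oo]).
    by apply/esym/cvg_lim => //; apply: cvg_nnsfun_approx.
  under eq_integral => x _ do rewrite fE.
  apply: monotone_convergence => //.
  - by move=> n; exact/measurable_EFinP.
  - by move=> n x _ /=; rewrite lee_fin.
  - by move=> x _ a b ab; rewrite lee_fin; exact/lefP/nd_nnsfun_approx.
have -> : \int[mu]_x (f x * (k x)%:E) =
    lim (\int[mu]_x ((h n x)%:E * (k x)%:E) @[n --> \oo]).
  have fE x : f x * (k x)%:E = lim ((h n x)%:E * (k x)%:E @[n --> \oo]).
    apply/esym/cvg_lim => //; apply: cvgeZr => //.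
    exact: cvg_nnsfun_approx.
  under eq_integral => x _ do rewrite fE.
  apply: monotone_convergence => //.
  - by move=> n; apply: emeasurable_funM => //; exact/measurable_EFinP.
  - by move=> n x _ /=; rewrite mule_ge0// lee_fin.
  - move=> x _ a b ab; rewrite lee_wpmul2r ?lee_fin//.
    exact/lefP/nd_nnsfun_approx.
congr (lim (_ @ \oo)); apply/funext => n.
have mind (r : R) : measurable_fun setT
    (fun x => (r * \1_(h n @^-1` [set r]) x)%:E : \bar R).
  by apply/measurable_EFinP; exact: measurable_funM.
transitivity (\int[nu]_x
   (\sum_(y \in range (h n)) (y * \1_(h n @^-1` [set y]) x)%:E)).
  by apply: eq_integral => t tE; rewrite /= fimfunE -fsumEFin.
rewrite ge0_integral_fsum//; last by move=> y x _; exact: nnfun_muleindic_ge0.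
transitivity (\int[mu]_x (\sum_(y \in range (h n))
    ((y * \1_(h n @^-1` [set y]) x)%:E * (k x)%:E))); last first.
  apply: eq_integral => x _.
  rewrite -ge0_mule_fsuml => [|y]; last exact: nnfun_muleindic_ge0.
  by rewrite fsumEFin// -fimfunE.
rewrite ge0_integral_fsum//; last 2 first.
  - by move=> y; exact: emeasurable_funM.
  - by move=> y x _; rewrite mule_ge0 ?lee_fin//; exact: nnfun_muleindic_ge0.
apply: eq_fsbigr => r; rewrite inE => -[t _ rt].
rewrite integralZl_indic_nnsfun// integral_indic// setIT nuE//.
under [RHS]eq_integral do rewrite EFinM -muleA.
rewrite ge0_integralZl//.
- congr (_ * _); rewrite integral_mkcond; apply: eq_integral => x _.
  by rewrite epatch_indic /= muleC.
- by apply: emeasurable_funM => //; exact/measurable_EFinP.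
- by move=> x _; rewrite mule_ge0// lee_fin.
- by rewrite -rt lee_fin.
Qed.

End density.

Section triangular.
Local Open Scope ereal_scope.

(** Summation of a double series along the antidiagonals. *)
Lemma nneseries_triangle (R : realType) (f : nat -> nat -> \bar R) :
  (forall a b, 0 <= f a b) ->
  \sum_(n <oo) \sum_(a < n.+1) f a (n - a)%N = \sum_(b <oo) \sum_(a <oo) f a b.
Proof.
move=> f0; pose g n a := if (a <= n)%N then f a (n - a)%N else 0.
have g0 n a : 0 <= g n a by rewrite /g; case: ifP.
transitivity (\sum_(n <oo) \sum_(a <oo) g n a).
  apply: eq_eseriesr => n _; rewrite (nneseries_split 0 n.+1)// add0n.
  rewrite [X in _ + X]eseries0 ?adde0; last first.
    by move=> i ni _; rewrite /g leqNgt ni.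
  rewrite big_mkord; apply: eq_bigr => a _.
  by rewrite /g -ltnS ltn_ord.
rewrite nneseries_interchange// [RHS]nneseries_interchange//.
apply: eq_eseriesr => a _.
rewrite (nneseries_split 0 a)// add0n big_nat_cond big1 ?add0e; last first.
  by move=> n /andP[/andP[_ na] _]; rewrite /g leqNgt na.
rewrite -nneseries_addn//; apply: eq_eseriesr => b _.
by rewrite /g leq_addl addnK.
Qed.

End triangular.

Section lebesgue_poisson_convolution.
Local Open Scope ereal_scope.
Variables (R : realType) (X : ptopologicalType) (hX : hausdorff_space X).
Variables (U : nat -> set X) (oU : forall i, open (U i)).
Hypothesis bU : forall x V, nbhs x V -> exists2 i, U i x & U i `<=` V.
Variable m : {sigma_finite_measure set (borel X) -> \bar R}.
Hypothesis m1 : forall x, m [set x] = 0.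
Local Notation pm n := (@power_measure R X m n).
Local Notation G := (Gamma0 X).
Local Notation lp := (lp_measure hX oU bU m1).
Let mconfig n := measurable_config hX oU bU (n := n).
Implicit Types h : {fset X} -> {fset X} -> R.

(** Integrating over two independent configurations amounts to integrating over
    one configuration and summing over its splittings. *)
Lemma lebesgue_poisson_pair h : measurable2 h -> (forall x y, (0 <= h x y)%R) ->
  \int[lp]_zeta \int[lp]_xi (h xi zeta)%:E =
  \int[lp]_eta (splitsum h eta)%:E.
Proof.
move=> mh h0.
pose c n : \bar R := ((n`!%:R)^-1)%:E.
have c0 n : 0 <= c n by rewrite lee_fin invfact_ge0.
rewrite [RHS]ge0_integral_lebesgue_poisson//; last 2 first.
  - by apply/measurable_EFinP; exact: (measurable_splitsum hX oU bU).
  - by move=> eta; rewrite lee_fin splitsum_ge0.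
have J0 a b : 0 <= pair_integral m a b h by exact: pair_integral_ge0.
transitivity (\sum_(n <oo) \sum_(a < n.+1)
    (c (n - a)%N * (c a * pair_integral m a (n - a) h))); last first.
  (* 'C(n, a) / n! = 1 / (a! (n - a)!) *)
  apply: eq_eseriesr => n _; rewrite (integral_splitsum hX oU bU m1)//.
  rewrite ge0_sume_distrr; last by move=> a _; rewrite mule_ge0// lee_fin.
  apply: eq_bigr => a _; rewrite !muleA; congr (_ * _).
  rewrite /c -!EFinM; congr EFin.
  have an : (a <= n)%N by rewrite -ltnS.
  rewrite -(bin_fact an) !natrM invfM mulrAC.
  rewrite mulVf ?pnatr_eq0 -?lt0n ?bin_gt0//.
  by rewrite mul1r invfM mulrC.
rewrite (nneseries_triangle
  (f := fun a b => c b * (c a * pair_integral m a b h))); last first.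
  by move=> a b; rewrite !mule_ge0.
have mh1 zeta : measurable_fun setT (fun xi : G => (h xi zeta)%:E).
  by apply/measurable_EFinP; exact: (measurable_fun_pair1 (zeta : G) mh).
pose g a zeta := \int[pm a]_s (h (config (tnth s)) zeta)%:E.
have mg a : measurable_fun setT (g a : G -> \bar R).
  pose f (q : G * a.-tuple (borel X)) := (h (config (tnth q.2)) q.1)%:E.
  have mf : measurable_fun setT f.
    apply/measurable_EFinP; apply: (measurableT_comp mh
      (g := fun q : G * a.-tuple (borel X) => (config (tnth q.2) : G, q.1))).
    by apply/measurable_fun_pair => //; exact: (measurableT_comp (@mconfig a)).
  by apply: (measurable_fun_fubini_tonelli_F (m2 := pm a) f mf) => q;
    rewrite lee_fin.
have g0 a zeta : 0 <= g a zeta by apply: integral_ge0 => s _; rewrite lee_fin.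
transitivity (\int[lp]_zeta \sum_(a <oo) (c a * g a zeta)).
  apply: eq_integral => zeta _; rewrite ge0_integral_lebesgue_poisson//.
  by move=> xi; rewrite lee_fin.
rewrite integral_nneseries//; last 2 first.
  - by move=> a; exact: measurable_funeM.
  - by move=> a zeta _; rewrite mule_ge0.
rewrite nneseries_interchange; last by move=> b a; rewrite !mule_ge0.
apply: eq_eseriesr => a _.
rewrite ge0_integralZl// ge0_integral_lebesgue_poisson//.
rewrite -nneseriesZl//; last first.
  by move=> b _; rewrite mule_ge0//; exact: integral_ge0.
by apply: eq_eseriesr => b _; rewrite muleCA.
Qed.

End lebesgue_poisson_convolution.

(** * Exhaustion by bounded sets and the density of the convolution *)

Section exhaustion.
Variables (X : ptopologicalType) (hX : hausdorff_space X).
Variables (U : nat -> set X) (oU : forall i, open (U i)).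
Hypothesis bU : forall x V, nbhs x V -> exists2 i, U i x & U i `<=` V.
Local Notation G := (Gamma0 X).
Variable L : nat -> set X.
Hypothesis LB : forall n, Bc (L n).
Hypothesis Lmono : {homo L : i j / (i <= j)%N >-> i `<=` j}.
Hypothesis LT : \bigcup_n L n = setT.

(** The configurations in A with at most N points: the sets that exhaust the
    bounded ones. *)
Definition window (A : set X) N : set G := \bigcup_(n in `I_N.+1) GammaY A n.

Lemma windowP (A : set X) N (eta : G) :
  window A N eta <->
  [set` (eta : {fset X})] `<=` A /\ (#|` (eta : {fset X})| <= N)%N.
Proof.
split => [[n /= nN [eA en]]|[eA eN]]; first by rewrite en -ltnS.
by exists #|` (eta : {fset X})|.
Qed.

Lemma config_bounded_window (A : set X) N : Bc A -> config_bounded (window A N).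
Proof.
move=> BA; split; last by exists A => //; exists N.
apply: bigcup_measurable => n _.
by apply: (measurable_GammaY hX oU bU); case: BA.
Qed.

Lemma window_union (A : set X) N (xi zeta : G) :
  window A N (config_union xi zeta) ->
  window A N xi /\ window A N zeta.
Proof.
move=> /windowP[uA uN]; split; apply/windowP; split.
- by move=> x xe; apply: uA; rewrite /= inE; apply/orP; left.
- by apply: leq_trans uN; apply: fsubset_leq_card; exact: fsubsetUl.
- by move=> x xe; apply: uA; rewrite /= inE; apply/orP; right.
- by apply: leq_trans uN; apply: fsubset_leq_card; exact: fsubsetUr.
Qed.

(** An increasing sequence of bounded sets covering the configuration space. *)
Definition win N := window (L N) N.

Lemma win_cover : \bigcup_N win N = setT.
Proof.
apply/seteqP; split => // eta _.
suff [N NP] : exists N, [set` (eta : {fset X})] `<=` L N.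
  exists (maxn N #|` (eta : {fset X})|) => //; apply/windowP; split.
    by apply: subset_trans NP _; apply: Lmono; exact: leq_maxl.
  exact: leq_maxr.
have f_ x : exists n, L n x.
  by have : (\bigcup_n L n) x by [rewrite LT]; move=> [n _ ?]; exists n.
have [f fP] := choice f_.
exists (\max_(x <- (eta : {fset X})) f x) => x xe.
apply: Lmono (fP x); exact: leq_bigmax_seq.
Qed.

Lemma measurable_win N : measurable (win N).
Proof. by have [] := config_bounded_window N (LB N). Qed.

Lemma locally_finite_sigma_finite (R : realType) (mu : set G -> \bar R) :
  locally_finite mu -> sigma_finite setT mu.
Proof.
move=> lf; exists win; first by rewrite win_cover.
by move=> N; split;
  [exact: measurable_win|apply: lf; exact: config_bounded_window].
Qed.

End exhaustion.

Section convolution.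
Local Open Scope ereal_scope.
Variables (R : realType) (X : ptopologicalType) (hX : hausdorff_space X).
Variables (U : nat -> set X) (oU : forall i, open (U i)).
Hypothesis bU : forall x V, nbhs x V -> exists2 i, U i x & U i `<=` V.
Variable m : {sigma_finite_measure set (borel X) -> \bar R}.
Hypothesis m1 : forall x, m [set x] = 0.
Local Notation G := (Gamma0 X).
Local Notation lp := (lp_measure hX oU bU m1).
Let munion := measurable_config_union hX oU bU.
Variables rho1 rho2 : {sigma_finite_measure set G -> \bar R}.
Variable rho : {measure set G -> \bar R}.
Hypotheses (lf1 : locally_finite rho1) (lf2 : locally_finite rho2).
Hypothesis rho_conv : is_convolution rho1 rho2 rho.
Variables k1 k2 : G -> R.
Hypotheses (mk1 : measurable_fun setT k1) (mk2 : measurable_fun setT k2).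
Hypotheses (k10 : forall x, (0 <= k1 x)%R) (k20 : forall x, (0 <= k2 x)%R).
Hypothesis rho1E : forall A, measurable A ->
  rho1 A = \int[lp]_(x in A) (k1 x)%:E.
Hypothesis rho2E : forall A, measurable A ->
  rho2 A = \int[lp]_(x in A) (k2 x)%:E.

Lemma measurable_indic_union (A : set G) : measurable A -> measurable_fun setT
  (fun p : G * G => (\1_A (config_union p.1 p.2) : R)%:E).
Proof.
move=> mA; apply/measurable_EFinP.
by apply: (measurableT_comp _ munion); exact: measurable_indic.
Qed.

(** If xi `|` zeta lies in a window then so do xi and zeta; the
    indicator is thus dominated by that of a product of two sets of finite
    measure. *)
Lemma integrable_indic_union (A : set G) : config_bounded A ->
  (rho1 \x rho2).-integrable setT
    (fun p : G * G => (\1_A (config_union p.1 p.2) : R)%:E).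
Proof.
move=> [mA [L BL [N AB]]]; apply/integrableP; split.
  exact: measurable_indic_union.
have bw := config_bounded_window hX oU bU N BL.
have mw : measurable (window L N) by case: bw.
apply: (@le_lt_trans _ _ (\int[rho1 \x rho2]_p
    (\1_(window L N `*` window L N) p : R)%:E)).
  apply: ge0_le_integral => //.
  - by apply: measurableT_comp => //; exact: measurable_indic_union.
  - by apply/measurable_EFinP; apply: measurable_indic; exact: measurableX.
  - move=> [xi zeta] _ /=; rewrite lee_fin !indicE ger0_norm//.
    have [/set_mem/AB uA|_] := boolP (config_union xi zeta \in A); last first.
      by rewrite mulr0n.
    have [w1 w2] := window_union uA.
    by rewrite mem_set.
rewrite integral_indic//; last exact: measurableX.
rewrite setIT [ltLHS](product_measure1E rho1 rho2 mw mw) lte_mul_pinfty//.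
  by rewrite ge0_fin_numE//; exact: lf1.
exact: lf2.
Qed.

Lemma convolution_bounded (A : set G) : config_bounded A ->
  rho A = \int[rho2]_zeta \int[rho1]_xi (\1_A (config_union xi zeta) : R)%:E.
Proof.
move=> bA; rewrite -rho_conv; last exact: integrable_indic_union.
by rewrite integral_indic ?setIT//; case: bA.
Qed.

Lemma convolution_finite (A : set G) : config_bounded A -> rho A < +oo.
Proof.
move=> bA; rewrite convolution_bounded//.
pose f (p : G * G) := (\1_A (config_union p.1 p.2) : R)%:E.
have mf : measurable_fun setT f by apply: measurable_indic_union; case: bA.
have f0 p : 0 <= f p by rewrite lee_fin.
rewrite -(fubini_tonelli2 (m1 := rho1) (m2 := rho2) f mf f0).
have /integrableP[_] := integrable_indic_union bA.
by under eq_integral => p _ do rewrite gee0_abs//.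
Qed.

Lemma star_ge0 eta : (0 <= star k1 k2 eta)%R.
Proof. by apply: sumr_ge0 => xi _; rewrite mulr_ge0. Qed.

Lemma measurable_star : measurable_fun setT (star k1 k2).
Proof.
apply: (measurable_splitsum hX oU bU (H := fun a b => (k1 a * k2 b)%R)).
by apply: measurable_funM; exact: measurableT_comp.
Qed.

Lemma iterated_integral_star (A : set G) : measurable A ->
  \int[rho2]_zeta \int[rho1]_xi (\1_A (config_union xi zeta) : R)%:E =
  \int[lp]_(eta in A) (star k1 k2 eta)%:E.
Proof.
move=> mA.
pose f (p : G * G) := (\1_A (config_union p.1 p.2) : R)%:E.
have mf : measurable_fun setT f by exact: measurable_indic_union.
have f0 p : 0 <= f p by rewrite lee_fin.
pose h (xi zeta : {fset X}) :=
  (\1_A (config_union xi zeta) * (k1 xi * k2 zeta) : R)%R.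
have h0 xi zeta : (0 <= h xi zeta)%R by rewrite /h !mulr_ge0.
have mh : measurable2 h.
  apply: measurable_funM; first exact/measurable_EFinP.
  by apply: measurable_funM; exact: measurableT_comp.
rewrite (ge0_integral_density mk2 k20 rho2E); last 2 first.
  - exact: (measurable_fun_fubini_tonelli_G (m1 := rho1) f mf f0).
  - by move=> zeta; exact: integral_ge0.
transitivity (\int[lp]_zeta \int[lp]_xi (h xi zeta)%:E).
  apply: eq_integral => zeta _.
  rewrite (ge0_integral_density mk1 k10 rho1E)//; last first.
    exact: (measurable_fun_pair1 zeta mf).
  rewrite muleC -ge0_integralZl ?lee_fin//.
  - by apply: eq_integral => xi _; rewrite /h -!EFinM mulrC mulrA.
  - apply: emeasurable_funM; first exact: (measurable_fun_pair1 zeta mf).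
    exact/measurable_EFinP.
  - by move=> xi _; rewrite mule_ge0// lee_fin.
rewrite (lebesgue_poisson_pair hX oU bU m1)// [RHS]integral_mkcond.
apply: eq_integral => eta _; rewrite epatch_indic -EFinM; congr EFin.
rewrite /splitsum /star mulr_suml; apply: eq_big_seq => xi.
rewrite fpowersetE => xe; rewrite /h mulrC; congr (_ * \1_A _)%R.
by apply/fsetP => x; rewrite !inE;
  case: (boolP (x \in xi)) => //= /(fsubsetP xe) ->.
Qed.

Variable L : nat -> set X.
Hypothesis LB : forall n, Bc (L n).
Hypothesis Lmono : {homo L : i j / (i <= j)%N >-> i `<=` j}.
Hypothesis LT : \bigcup_n L n = setT.

(** By [iterated_integral_star] on bounded sets, and by cutting A along the
    exhausting sequence in general. *)
Lemma convolution_star (A : set G) : measurable A ->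
  rho A = \int[lp]_(eta in A) (star k1 k2 eta)%:E.
Proof.
move=> mA; have mwin := measurable_win hX oU bU LB.
pose F N := A `&` seqDU (win L) N.
have mF N : measurable (F N).
  apply: measurableI => //; exact: seqDU_measurable.
have tF : trivIset setT F by apply: trivIset_setIl; exact: trivIset_seqDU.
have AF : A = \bigcup_N F N.
  by rewrite -setI_bigcupr -seqDU_bigcup_eq win_cover// setIT.
rewrite AF measure_bigcup// ge0_integral_bigcup//.
- rewrite (@eq_eseriesl _ _ xpredT); last by move=> i; rewrite in_setT.
  apply: eq_eseriesr => N _.
  have bF : config_bounded (F N).
    split => //; exists (L N) => //; exists N => eta [_]; exact: subset_seqDU.
  by rewrite convolution_bounded// iterated_integral_star.
- apply/measurable_funTS/measurable_EFinP; exact: measurable_star.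
- by move=> eta _; rewrite lee_fin star_ge0.
Qed.

Lemma convolution_density_unique (k : G -> R) : measurable_fun setT k ->
  (forall A, measurable A -> rho A = \int[lp]_(eta in A) (k eta)%:E) ->
  {ae lp, forall eta, k eta = star k1 k2 eta}.
Proof.
move=> mk kE.
have step N : lp.-negligible [set eta | win L N eta /\ k eta <> star k1 k2 eta].
  have bw : config_bounded (win L N) by exact: config_bounded_window.
  have mw : measurable (win L N) by case: bw.
  have [M [mM M0 sM]] : ae_eq lp (win L N) (EFin \o star k1 k2) (EFin \o k).
    apply: integral_ae_eq => //.
    - apply/integrableP; split.
        by apply/measurable_funTS/measurable_EFinP; exact: measurable_star.
      under eq_integral => eta _ do rewrite gee0_abs ?lee_fin ?star_ge0//.
      by rewrite -convolution_star//; exact: convolution_finite.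
    - exact/measurable_funTS/measurable_EFinP.
    - by move=> E EW mE; rewrite -convolution_star// kE.
  exists M; split => // eta [we ke]; apply: sM => /= /(_ we) [] e.
  by apply: ke.
have : lp.-negligible (\bigcup_N
    [set eta | win L N eta /\ k eta <> star k1 k2 eta]).
  exact: negligible_bigcup.
apply: negligibleS => eta /= ke.
have [N _ we] : (\bigcup_N win L N) eta by rewrite win_cover.
by exists N.
Qed.

End convolution.

Theorem proposition5p3 (R : realType) (d : nat) (X : ptopologicalType)
  (M : oriented_riemannian_manifold R d X)
  (Xconnected : connected [set: X])
  (Xnoncompact : ~ compact [set: X])
  (Xexhaustible : exhaustible X)
  (m : {measure set (borel X) -> \bar R})
  (mradon : nonatomic_radon m)
  (rho1 rho2 rho : {measure set (Gamma0 X) -> \bar R})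
  (rho1_lf : locally_finite rho1)
  (rho2_lf : locally_finite rho2)
  (k1 k2 : Gamma0 X -> R)
  (rho1_k1 : is_RN_derivative rho1 (lebesgue_poisson m) k1)
  (rho2_k2 : is_RN_derivative rho2 (lebesgue_poisson m) k2)
  (rho_conv : is_convolution rho1 rho2 rho) :
  (exists k : Gamma0 X -> R, is_RN_derivative rho (lebesgue_poisson m) k) /\
  (forall k : Gamma0 X -> R, is_RN_derivative rho (lebesgue_poisson m) k ->
     {ae lebesgue_poisson m, forall eta, k eta = star k1 k2 eta}).
Proof.
have hX := manifold_hausdorff M.
have [U oU bU] := second_countable_sequence (manifold_second_countable M).
have [L [LB Lmono LT]] := Xexhaustible.
have [m_fin m_atom] := mradon.
have sm : sigma_finite setT m.
  by exists L => // n; split; [case: (LB n)|exact: m_fin].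
pose m' := as_sigma_finite sm.
pose rho1' := as_sigma_finite
  (locally_finite_sigma_finite hX oU bU LB Lmono LT rho1_lf).
pose rho2' := as_sigma_finite
  (locally_finite_sigma_finite hX oU bU LB Lmono LT rho2_lf).
have [mk1 k10 rho1E] := rho1_k1; have [mk2 k20 rho2E] := rho2_k2.
split.
  exists (star k1 k2); split.
  - exact: (measurable_star hX oU bU).
  - exact: star_ge0.
  - move=> A mA.
    exact: (convolution_star (hX := hX) (oU := oU) (bU := bU)
      (m := m') (rho1 := rho1') (rho2 := rho2') (m1 := m_atom)
      rho1_lf rho2_lf rho_conv mk1 mk2 k10 k20 rho1E rho2E
      LB Lmono LT mA).
move=> k [mk k0 rhoE].
exact: (convolution_density_unique (hX := hX) (oU := oU) (bU := bU)
  (m := m') (rho1 := rho1') (rho2 := rho2') (m1 := m_atom)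
  rho1_lf rho2_lf rho_conv mk1 mk2 k10 k20 rho1E rho2E LB Lmono LT mk rhoE).
Qed.
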